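(* Let $(\mathcal{C},\phi,\Delta)$ be a cyclic categorical Garside structure with Garside groupoid $\mathcal{G}$. Let $p,q$ be positive integers and let $\rho=s\Delta^k$ be a $\frac{p}{q}$-periodic loop in $\mathcal{G}$ (i.e. $\rho$ is a loop with $\rho^q=\Delta^p$), where $k\in\mathbb{Z}$ and $s$ is a simple morphism of $\mathcal{C}$ such that $$s\,s^{\phi^{-k}}s^{\phi^{-2k}}\cdots s^{\phi^{-(q-1)k}}=\Delta$$ (so that $p=qk+1$). Put $s_i:=s^{\phi^{-(i-1)k}}$ and $\underline{s}:=(s_1,\dots,s_q)$, which is an object of the $q$-divided Garside groupoid $\mathcal{G}_q$, and let $\Theta_q:\mathcal{G}\to\mathcal{G}_q$ be the canonical functor. Then $\Theta_q(\rho)$ is conjugate in the groupoid $\mathcal{G}_q$ to the element $\Delta_q^p$ (product of $p$ successive Garside elements of $\mathcal{G}_q$) with source $\underline{s}$; that is, there is a morphism $c$ of $\mathcal{G}_q$ with $\Theta_q(\rho)\,c=c\,\Delta_q^p$, where $\Delta_q^p$ has source $\underline s$.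
   Context: Conventions. Morphisms compose like paths: $x\xrightarrow{f}y\xrightarrow{g}z$ has composite $fg$. The image of an object or morphism under an automorphism $\phi$ is written $x^\phi$, $f^\phi$. In a category $\mathcal{C}$, $\mathcal{C}_{x\to}$ (resp. $\mathcal{C}_{\to x}$) is the set of morphisms with source (resp. target) $x$; $f\le g$ on $\mathcal{C}_{x\to}$ means $g=fh$ for some $h$; $g\ge h$ on $\mathcal{C}_{\to x}$ means $g=fh$ for some $f$. An atom is a non-identity morphism that is not a product of two non-identity morphisms. A loop is an endomorphism of an object. A categorical Garside structure is a triple $(\mathcal{C},\phi,\Delta)$ where $\mathcal{C}$ is a small category, $\phi$ is an automorphism of $\mathcal{C}$ and $\Delta$ is a natural transformation from the identity functor to $\phi$ (so $\Delta_x:x\to x^\phi$ and $f\Delta_y=\Delta_xf^\phi$ for $f:x\to y$), such that: $\mathcal{C}$ is homogeneous (there is a function $l$ from morphisms to $\mathbb{Z}_{\ge0}$ with $l(fg)=l(f)+l(g)$ and $l(f)=0$ iff $f$ is an identity); $\mathcal{C}$ is cancellative ($afb=agb$ implies $f=g$); every atom is simple, where $f:x\to y$ is simple if there is $\overline f:y\to x^\phi$ with $f\overline f=\Delta_x$ ($\overline f$ is then unique); for every object $x$, $(\mathcal{C}_{x\to},\le)$ and $(\mathcal{C}_{\to x},\ge)$ are lattices. It is cyclic if $\phi^n=1$ for some $n\ge1$. The Garside groupoid $\mathcal{G}$ is obtained from $\mathcal{C}$ by formally inverting all morphisms ($\mathcal{C}$ embeds in it, and $\phi,\Delta$ extend to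 it). $\Delta^j$ with a given source $x$ ($j\ge0$) is $\Delta_x\Delta_{x^\phi}\cdots\Delta_{x^{\phi^{j-1}}}$; sources of $\Delta$'s are omitted when determined by context. Divided category. For $m\ge1$, let $D_m$ be the set of sequences $f=(f_1,\dots,f_m)$ of composable $\mathcal{C}$-morphisms with $f_1\cdots f_m=\Delta_{x_1}$, $x_1$ the source of $f_1$. Let $S_m$ be the oriented graph with vertex set $D_m$ in which an edge $f\to g$ is a sequence $s=(s_1,\dots,s_m)$ of simple morphisms of $\mathcal{C}$, $s_i$ going from the source of $f_i$ to the source of $g_i$, for which there are factorisations $f_i=s_is'_i$ with $g_i=s'_is_{i+1}$ for $i=1,\dots,m$ (with $s_{m+1}:=s_1^\phi$). For edges $s:f\to g$, $t:g\to h$, the partial product $st:=(s_1t_1,\dots,s_mt_m)$ is defined exactly when each $s_it_i$ is simple and $(s_1t_1,\dots,s_mt_m)$ is an edge $f\to h$. The category $\mathcal{C}_m$ has object set $D_m$ and morphisms generated by the edges of $S_m$, subject to the relations that the formal composite of $s$ and $t$ equals $st$ whenever the partial product is defined, and that the edge $(1,\dots,1):f\to f$ is the identity of $f$. The automorphism $\phi_m$ of $\mathcal{C}_m$ is $(f_1,\dots,f_m)^{\phi_m}=(f_2,\dots,f_m,f_1^\phi)$, $(s_1,\dots,s_m)^{\phi_m}=(s_2,\dots,s_m,s_1^\phi)$, and the Garside element $\Delta_{m,f}:f\to f^{\phi_m}$ is the edge $(f_1,\dots,f_m)$. $(\mathcal{C}_m,\phi_m,\Delta_m)$ is a categorical Garside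 structure and $\mathcal{G}_m$ denotes its Garside groupoid. The functor $\Theta_m:\mathcal{C}\to\mathcal{C}_m$ (and the induced functor $\mathcal{G}\to\mathcal{G}_m$) is defined by $\Theta_m(x):=(1_x,\dots,1_x,\Delta_x)$ on objects, and on a simple morphism $s:x\to y$ by the composite of $m$ edges $A_0\to A_1\to\cdots\to A_m$, where $A_0=\Theta_m(x)$, $A_m=\Theta_m(y)$, for $1\le j\le m-1$ $A_j\in D_m$ has $(m-j)$-th term $s$, $m$-th term $\overline s$ and all other terms identities, and for $1\le j\le m$ the edge $A_{j-1}\to A_j$ has $(m+1-j)$-th component $s$ and all other components identities. *)

(* Defs.v *)
From mathcomp Require Import all_boot ssralg ssrint.
From mathcomp Require Import boolp.

Set Implicit Arguments.
Unset Strict Implicit.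
Unset Printing Implicit Defensive.

Declare Scope cat_scope.
Delimit Scope cat_scope with cat.
Local Open Scope quotient_scope.
Local Open Scope cat_scope.

Record quiver := Quiver {
  ob :> Type;
  mor : Type;
  src : mor -> ob;
  tgt : mor -> ob }.

Arguments src {q} _ : simpl never.
Arguments tgt {q} _ : simpl never.

Fixpoint chain (Q : quiver) (x : Q) (l : seq (mor Q)) (y : Q) : Prop :=
  match l with
  | [::] => x = y
  | f :: l' => src f = x /\ chain (tgt f) l' y
  end.

(* Composition, written in path order, is a total operation on [mor] whose
   value is unspecified when [tgt f <> src g]; all the axioms are guarded. *)
Record category := Category {
  quiv :> quiver;
  idm : quiv -> mor quiv;
  mcomp : mor quiv -> mor quiv -> mor quiv;
  src_id : forall x, src (idm x) = x;
  tgt_id : forall x, tgt (idm x) = x;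
  src_comp : forall f g, tgt f = src g -> src (mcomp f g) = src f;
  tgt_comp : forall f g, tgt f = src g -> tgt (mcomp f g) = tgt g;
  comp1m : forall f, mcomp (idm (src f)) f = f;
  compm1 : forall f, mcomp f (idm (tgt f)) = f;
  compA : forall f g h, tgt f = src g -> tgt g = src h ->
    mcomp f (mcomp g h) = mcomp (mcomp f g) h }.

Arguments mcomp {c} _ _ : simpl never.
Arguments idm {c} _ : simpl never.
Notation "f ** g" := (mcomp f g) (at level 40, left associativity) : cat_scope.

Definition is_id (C : category) (f : mor C) : Prop := f = idm (src f).

Definition composes (C : category) (f g h : mor C) : Prop :=
  tgt f = src g /\ f ** g = h.

Fixpoint product (C : category) (x : C) (l : seq (mor C)) : mor C :=
  match l with
  | [::] => idm x
  | f :: l' => f ** product (tgt f) l'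
  end.

Definition power (C : category) (f : mor C) (n : nat) : mor C :=
  product (src f) (nseq n f).

Record functor (C D : category) := Functor {
  fob :> C -> D;
  fmor : mor C -> mor D;
  fsrc : forall f, src (fmor f) = fob (src f);
  ftgt : forall f, tgt (fmor f) = fob (tgt f);
  fid : forall x, fmor (idm x) = idm (fob x);
  fcomp : forall f g, tgt f = src g -> fmor (f ** g) = fmor f ** fmor g }.

Record word (Q : quiver) := Word {
  wsrc : Q; wseq : seq (mor Q); wtgt : Q; wchain : chain wsrc wseq wtgt }.

Inductive cong (Q : quiver) (R : seq (mor Q) -> seq (mor Q) -> Prop) :
  Q -> Q -> seq (mor Q) -> seq (mor Q) -> Prop :=
| cong_rel x y a b : R a b -> chain x a y -> chain x b y -> cong R x y a b
| cong_refl x y a : chain x a y -> cong R x y a a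
| cong_sym x y a b : cong R x y a b -> cong R x y b a
| cong_trans x y a b c : cong R x y a b -> cong R x y b c -> cong R x y a c
| cong_cat x y z a a' b b' : cong R x y a a' -> cong R y z b b' ->
    cong R x z (a ++ b) (a' ++ b').

Definition word_eq (Q : quiver) (R : seq (mor Q) -> seq (mor Q) -> Prop)
    (u v : word Q) : Prop :=
  [/\ wsrc u = wsrc v, wtgt u = wtgt v
    & cong R (wsrc u) (wtgt u) (wseq u) (wseq v)].

Section Presentation.
Variables (Q : quiver) (R : seq (mor Q) -> seq (mor Q) -> Prop).

Lemma chain_cat (x y z : Q) a b :
  chain x a y -> chain y b z -> chain x (a ++ b) z.
Proof.
by elim: a x => [|f a IH] x /= => [-> //|[-> h] hb]; split=> //; apply: IH.
Qed.

Lemma chain_tgt (x y z : Q) a : chain x a y -> chain x a z -> y = z.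
Proof.
elim: a x => [|f a IH] x /= => [<- // |[_ h] [_ h']]; exact: (IH _ h h').
Qed.

Lemma cong_chain x y a b : cong R x y a b -> chain x a y /\ chain x b y.
Proof.
elim=> {x y a b} //.
- by move=> x y a b _ [].
- by move=> x y a b c _ [h1 h2] _ [h3 h4].
- move=> x y z a a' b b' _ [h1 h2] _ [h3 h4].
  by split; apply: chain_cat; eauto.
Qed.

Definition word_eqb (u v : {classic word Q}) : bool := `[< word_eq R u v >].

Lemma word_eqb_refl : reflexive word_eqb.
Proof. by move=> u; apply/asboolP; split=> //; apply/cong_refl/wchain. Qed.

Lemma word_eqb_sym : symmetric word_eqb.
Proof.
suff h u v : word_eqb u v -> word_eqb v u.
  by move=> u v; apply/idP/idP; apply: h.
move=> /asboolP [e1 e2 h]; apply/asboolP; split=> //; apply: cong_sym.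
by rewrite -e1 -e2.
Qed.

Lemma word_eqb_trans : transitive word_eqb.
Proof.
move=> v u w /asboolP [e1 e2 h] /asboolP [e3 e4 h']; apply/asboolP.
split; [by rewrite e1|by rewrite e2|].
by apply: (cong_trans h); rewrite e1 e2.
Qed.

Canonical word_equiv := EquivRel word_eqb word_eqb_refl word_eqb_sym
  word_eqb_trans.

Definition wclass := {eq_quot word_equiv}.

Definition cls (w : word Q) : wclass := \pi_(wclass) (w : {classic word Q}).

Lemma clsP (u v : word Q) : cls u = cls v <-> word_eq R u v.
Proof.
split; first by move/eqmodP=> /asboolP.
by move=> h; apply/eqmodP/asboolP.
Qed.

Lemma cls_repr (c : wclass) : cls (repr c) = c.
Proof. exact: reprK. Qed.

Lemma cls_ind (P : wclass -> Prop) : (forall w, P (cls w)) -> forall c, P c.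
Proof. by move=> h c; rewrite -(cls_repr c). Qed.

Definition empty_word (x : Q) : word Q := @Word Q x [::] x erefl.

Definition cat_word (u v : word Q) (h : wtgt u = wsrc v) : word Q :=
  Word (chain_cat (wchain u) (eq_ind_r (fun y => chain y _ _) (wchain v) h)).

Definition pres_src (c : wclass) : Q := wsrc (repr c).
Definition pres_tgt (c : wclass) : Q := wtgt (repr c).
Definition pres_comp (c d : wclass) : wclass :=
  if pselect (wtgt (repr c) = wsrc (repr d)) is left h
  then cls (cat_word h) else c.

Lemma repr_cls w : word_eq R (repr (cls w)) w.
Proof. by apply/clsP; rewrite cls_repr. Qed.

Lemma pres_src_cls w : pres_src (cls w) = wsrc w.
Proof. by rewrite /pres_src; case: (repr_cls w). Qed.

Lemma pres_tgt_cls w : pres_tgt (cls w) = wtgt w.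
Proof. by rewrite /pres_tgt; case: (repr_cls w). Qed.

Lemma pres_comp_cls u v (h : wtgt u = wsrc v) :
  pres_comp (cls u) (cls v) = cls (cat_word h).
Proof.
have [u1 u2 u3] := repr_cls u; have [v1 v2 v3] := repr_cls v.
rewrite /pres_comp; case: pselect => [h'|]; last by rewrite u2 v1.
apply/clsP; split=> //=; apply: (cong_cat u3).
by rewrite h'.
Qed.

Lemma pres_src_comp c d : pres_tgt c = pres_src d ->
  pres_src (pres_comp c d) = pres_src c.
Proof.
elim/cls_ind: c => u; elim/cls_ind: d => v.
rewrite pres_tgt_cls pres_src_cls => h.
by rewrite pres_comp_cls !pres_src_cls.
Qed.

Lemma pres_tgt_comp c d : pres_tgt c = pres_src d ->
  pres_tgt (pres_comp c d) = pres_tgt d.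
Proof.
elim/cls_ind: c => u; elim/cls_ind: d => v.
rewrite pres_tgt_cls pres_src_cls => h.
by rewrite pres_comp_cls !pres_tgt_cls.
Qed.

Lemma pres_comp1m c : pres_comp (cls (empty_word (pres_src c))) c = c.
Proof.
elim/cls_ind: c => u; rewrite pres_src_cls (pres_comp_cls (u := empty_word _)) //.
by apply/clsP; split=> //=; apply/cong_refl/wchain.
Qed.

Lemma pres_compm1 c : pres_comp c (cls (empty_word (pres_tgt c))) = c.
Proof.
elim/cls_ind: c => u; rewrite pres_tgt_cls (pres_comp_cls (v := empty_word _)) //.
apply/clsP; split=> //=; rewrite cats0; apply/cong_refl/wchain.
Qed.

Lemma pres_compA c d e : pres_tgt c = pres_src d -> pres_tgt d = pres_src e ->
  pres_comp c (pres_comp d e) = pres_comp (pres_comp c d) e.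
Proof.
elim/cls_ind: c => u; elim/cls_ind: d => v; elim/cls_ind: e => w.
rewrite !pres_tgt_cls !pres_src_cls => h1 h2.
rewrite !pres_comp_cls //=; apply/clsP; split=> //=; rewrite -catA.
apply/cong_refl/(chain_cat (wchain u)); rewrite h1.
by apply: (chain_cat (wchain v)); rewrite h2; apply: wchain.
Qed.

(* A relation of [R] is imposed at each object from which both of its sides are
   paths with a common target. *)
Definition presented : category :=
  @Category (@Quiver Q wclass pres_src pres_tgt)
    (fun x => cls (empty_word x)) pres_comp
    (fun x => pres_src_cls (empty_word x))
    (fun x => pres_tgt_cls (empty_word x))
    pres_src_comp pres_tgt_comp pres_comp1m pres_compm1 pres_compA.

Definition gen (e : mor Q) : mor presented :=
  cls (@Word Q (src e) [:: e] (tgt e) (conj erefl erefl)).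

Lemma src_gen e : src (gen e) = src e. Proof. exact: pres_src_cls. Qed.
Lemma tgt_gen e : tgt (gen e) = tgt e. Proof. exact: pres_tgt_cls. Qed.

Lemma cls_product w : cls w = product (wsrc w : presented) (map gen (wseq w)).
Proof.
case: w => x l y /=; elim: l x => [|e l IH] x /= h.
  by subst y; congr cls; congr Word; apply: Prop_irrelevance.
case: (h) => h1 h2; subst x.
rewrite [tgt (gen e)]pres_tgt_cls /= -(IH _ h2).
rewrite [_ ** _] (pres_comp_cls (u := Word _) (v := Word _)) //.
by apply/clsP; split=> //=; apply: cong_refl.
Qed.

Lemma pres_ind (P : mor presented -> Prop) :
  (forall (x : Q) l y, chain x l y -> P (product (x : presented) (map gen l))) ->
  forall c, P c.
Proof.
by move=> h; elim/cls_ind => w; rewrite cls_product; apply/h/wchain.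
Qed.

Lemma pres_rel x y a b : R a b -> chain x a y -> chain x b y ->
  product (x : presented) (map gen a) = product (x : presented) (map gen b).
Proof.
move=> r ha hb.
have := cls_product (Word ha); have := cls_product (Word hb) => /= <- <-.
by apply/clsP; split=> //=; apply: cong_rel.
Qed.

End Presentation.

Section CategoryTheory.
Variable C : category.
Implicit Types (x y z : C) (f g h : mor C).

Lemma src_product x l y : chain x l y -> src (product x l) = x.
Proof.
elim: l x => [|f l IH] x /=; first by rewrite src_id.
by case=> <- h; rewrite src_comp // IH.
Qed.

Lemma tgt_product x l y : chain x l y -> tgt (product x l) = y.
Proof.
elim: l x => [|f l IH] x /=; first by rewrite tgt_id.
by case=> _ h; rewrite tgt_comp ?(IH _ h) // (src_product h).
Qed.

Lemma product_cat x l y l' z : chain x l y -> chain y l' z ->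
  product x (l ++ l') = product x l ** product y l'.
Proof.
elim: l x => [|f l IH] x /=.
  by move=> -> h; rewrite -[in idm _](src_product h) comp1m.
case=> _ h h'; rewrite (IH _ h h') compA ?(src_product h) ?(tgt_product h) //.
by rewrite (src_product h').
Qed.

Lemma product1 f x : product x [:: f] = f.
Proof. by rewrite /= compm1. Qed.
End CategoryTheory.

Section Lift.
Variables (Q : quiver) (R : seq (mor Q) -> seq (mor Q) -> Prop) (D : category).
Variables (fo : Q -> D) (fm : mor Q -> mor D).
Hypothesis fm_src : forall e, src (fm e) = fo (src e).
Hypothesis fm_tgt : forall e, tgt (fm e) = fo (tgt e).
Hypothesis fm_rel : forall x y a b, R a b -> chain x a y -> chain x b y ->
  product (fo x) (map fm a) = product (fo x) (map fm b).

Lemma chain_map x l y : chain x l y -> chain (fo x) (map fm l) (fo y).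
Proof.
elim: l x => [|e l IH] x /=; first by move->.
by case=> <- h; rewrite fm_src fm_tgt; split=> //; apply: IH.
Qed.

Lemma cong_product x y a b : cong R x y a b ->
  product (fo x) (map fm a) = product (fo x) (map fm b).
Proof.
elim=> {x y a b} //.
- by move=> x y a b c _ -> _ ->.
- move=> x y z a a' b b' /cong_chain [h1 h2] e1 /cong_chain [h3 h4] e2.
  rewrite !map_cat (product_cat (chain_map h1) (chain_map h3)).
  by rewrite (product_cat (chain_map h2) (chain_map h4)) e1 e2.
Qed.

Definition lift_mor (c : mor (presented R)) : mor D :=
  product (fo (wsrc (repr c))) (map fm (wseq (repr c))).

Lemma lift_cls w : lift_mor (cls R w) = product (fo (wsrc w)) (map fm (wseq w)).
Proof.
rewrite /lift_mor; case: (repr_cls R w) => e1 e2 h.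
by rewrite (cong_product h) e1.
Qed.

Lemma lift_src c : src (lift_mor c) = fo (src c).
Proof. by rewrite (src_product (chain_map (wchain (repr c)))). Qed.

Lemma lift_tgt c : tgt (lift_mor c) = fo (tgt c).
Proof. by rewrite (tgt_product (chain_map (wchain (repr c)))). Qed.

Lemma lift_id (x : presented R) : lift_mor (idm x) = idm (fo x).
Proof. exact: lift_cls. Qed.

Lemma lift_comp c d : tgt c = src d ->
  lift_mor (c ** d) = lift_mor c ** lift_mor d.
Proof.
elim/cls_ind: c => u; elim/cls_ind: d => v.
rewrite [tgt _]pres_tgt_cls [src _]pres_src_cls => h.
rewrite [_ ** _](pres_comp_cls R h) !lift_cls /= map_cat.
have hv := chain_map (wchain v); rewrite -h in hv.
by rewrite (product_cat (chain_map (wchain u)) hv) h.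
Qed.

Definition lift : functor (presented R) D :=
  @Functor (presented R) D fo lift_mor lift_src lift_tgt lift_id lift_comp.

Lemma lift_gen e : fmor lift (gen R e) = fm e.
Proof. by rewrite /= /gen lift_cls product1. Qed.
End Lift.

(* [inl f] stands for [f] and [inr f] for its formal inverse. *)
Definition loc_quiver (C : category) : quiver :=
  @Quiver C (mor C + mor C)%type
    (fun e => match e with inl f => src f | inr f => tgt f end)
    (fun e => match e with inl f => tgt f | inr f => src f end).

Inductive loc_rel (C : category) :
  seq (mor (loc_quiver C)) -> seq (mor (loc_quiver C)) -> Prop :=
| loc_id x : loc_rel [:: inl (idm x)] [::]
| loc_comp f g : tgt f = src g -> loc_rel [:: inl f; inl g] [:: inl (f ** g)]
| loc_invr f : loc_rel [:: inl f; inr f] [::]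
| loc_invl f : loc_rel [:: inr f; inl f] [::].

Definition groupoid (C : category) : category := presented (@loc_rel C).

Definition emb (C : category) (f : mor C) : mor (groupoid C) :=
  gen (@loc_rel C) (inl f).

Definition embV (C : category) (f : mor C) : mor (groupoid C) :=
  gen (@loc_rel C) (inr f).

Section Groupoid.
Variable C : category.

Lemma src_emb (f : mor C) : src (emb f) = src f. Proof. exact: src_gen. Qed.
Lemma tgt_emb (f : mor C) : tgt (emb f) = tgt f. Proof. exact: tgt_gen. Qed.
Lemma src_embV (f : mor C) : src (embV f) = tgt f. Proof. exact: src_gen. Qed.
Lemma tgt_embV (f : mor C) : tgt (embV f) = src f. Proof. exact: tgt_gen. Qed.

Lemma emb_id (x : C) : emb (idm x) = @idm (groupoid C) x.
Proof.
have h : @chain (loc_quiver C) x [:: inl (idm x)] x.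
  by split; [exact: src_id|exact: tgt_id].
by have /= := pres_rel (loc_id x) h; move/(_ erefl); rewrite !compm1.
Qed.

Lemma emb_comp (f g : mor C) : tgt f = src g -> emb (f ** g) = emb f ** emb g.
Proof.
move=> e.
have h : @chain (loc_quiver C) (src f) [:: inl f; inl g] (tgt g) by [].
have h' : @chain (loc_quiver C) (src f) [:: inl (f ** g)] (tgt g).
  by split; [exact: src_comp|exact: tgt_comp].
by have /= := pres_rel (loc_comp e) h h'; rewrite !compm1.
Qed.

Lemma emb_invr (f : mor C) : emb f ** embV f = @idm (groupoid C) (src f).
Proof.
have h : @chain (loc_quiver C) (src f) [:: inl f; inr f] (src f) by [].
by have /= := pres_rel (loc_invr f) h; move/(_ erefl); rewrite !compm1.
Qed.

Lemma emb_invl (f : mor C) : embV f ** emb f = @idm (groupoid C) (tgt f).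
Proof.
have h : @chain (loc_quiver C) (tgt f) [:: inr f; inl f] (tgt f) by [].
by have /= := pres_rel (loc_invl f) h; move/(_ erefl); rewrite !compm1.
Qed.

Lemma emb_inv (e : mor (loc_quiver C)) : exists d : mor (groupoid C),
  composes (gen (@loc_rel C) e) d (idm (src e : groupoid C)) /\
  composes d (gen (@loc_rel C) e) (idm (tgt e : groupoid C)).
Proof.
case: e => f.
  exists (embV f); split; split; rewrite ?emb_invr ?emb_invl //.
    by rewrite tgt_emb src_embV.
  by rewrite tgt_embV src_emb.
exists (emb f); split; split; rewrite ?emb_invr ?emb_invl //.
  by rewrite tgt_embV src_emb.
by rewrite tgt_emb src_embV.
Qed.

Lemma groupoid_inv (c : mor (groupoid C)) : exists d,
  composes c d (idm (src c)) /\ composes d c (idm (tgt c)).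
Proof.
have mul (K : category) (f f' g g' : mor K) : tgt f = src g ->
    composes f f' (idm (src f)) -> composes f' f (idm (tgt f)) ->
    composes g g' (idm (src g)) -> composes g' g (idm (tgt g)) ->
    composes (f ** g) (g' ** f') (idm (src f)) /\
    composes (g' ** f') (f ** g) (idm (tgt g)).
  move=> e [f1 f2] [f3 f4] [g1 g2] [g3 g4].
  have h1 : tgt g' = src f'.
    by rewrite -f1 e -(tgt_comp g1) g2 tgt_id.
  split; split; rewrite ?src_comp ?tgt_comp //.
    by rewrite -compA ?src_comp // (compA g1 h1) g2 -e f1 comp1m.
  by rewrite -compA ?src_comp ?tgt_comp // (compA f3 e) f4 e comp1m.
elim/pres_ind: c => x l y; elim: l x => [|e l IH] x.
  move=> _; exists (@idm (groupoid C) x).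
  have := comp1m (@idm (groupoid C) x).
  by rewrite /= /composes !src_id !tgt_id => ->.
case=> <- h; have [d [d1 d2]] := IH _ h; have [g [g1 g2]] := emb_inv e.
have hc := @chain_map (loc_quiver C) (groupoid C) (fun z => z) (gen (@loc_rel C))
  (@src_gen _ _) (@tgt_gen _ _) _ _ _ h.
have ce : tgt (gen (@loc_rel C) e) = tgt e by apply: tgt_gen.
have se : src (gen (@loc_rel C) e) = src e by apply: src_gen.
have sc := src_product hc; rewrite -ce in sc.
exists (d ** g); rewrite -se -ce in g1 g2 d1 d2.
have := mul (groupoid C) _ _ _ _ (esym sc) g1 g2 d1 d2.
by rewrite src_comp // tgt_comp.
Qed.
End Groupoid.

Section GroupoidFunctor.
Variables (C D : category) (F : functor C D).

Let fm (e : mor (loc_quiver C)) : mor (groupoid D) :=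
  match e with inl f => emb (fmor F f) | inr f => embV (fmor F f) end.

Lemma gfunctor_src e : src (fm e) = fob F (src e) :> groupoid D.
Proof.
by case: e => f /=; [rewrite src_emb fsrc|rewrite src_embV ftgt].
Qed.

Lemma gfunctor_tgt e : tgt (fm e) = fob F (tgt e) :> groupoid D.
Proof.
by case: e => f /=; [rewrite tgt_emb ftgt|rewrite tgt_embV fsrc].
Qed.

Lemma gfunctor_rel x y a b : loc_rel a b -> chain x a y -> chain x b y ->
  product (F x : groupoid D) (map fm a) = product (F x : groupoid D) (map fm b).
Proof.
case=> [z|f g h|f|f] /=.
- by move=> [<- _] _; rewrite compm1 fid emb_id [src _]src_id.
- by move=> _ _; rewrite !compm1 fcomp // emb_comp // fsrc ftgt h.
- by case=> <- _ _; rewrite compm1 emb_invr fsrc.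
- by case=> <- _ _; rewrite compm1 emb_invl ftgt.
Qed.

Definition groupoid_functor : functor (groupoid C) (groupoid D) :=
  lift gfunctor_src gfunctor_tgt gfunctor_rel.

Lemma groupoid_functor_emb f : fmor groupoid_functor (emb f) = emb (fmor F f).
Proof. exact: lift_gen. Qed.

Lemma groupoid_functor_embV f :
  fmor groupoid_functor (embV f) = embV (fmor F f).
Proof. exact: lift_gen. Qed.
End GroupoidFunctor.

Definition is_lattice (T : Type) (A : T -> Prop) (le : T -> T -> Prop) : Prop :=
  [/\ forall a, A a -> le a a,
      forall a b, A a -> A b -> le a b -> le b a -> a = b,
      forall a b c, A a -> A b -> A c -> le a b -> le b c -> le a c,
      forall a b, A a -> A b -> exists u, [/\ A u, le a u, le b u
        & forall v, A v -> le a v -> le b v -> le u v]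
    & forall a b, A a -> A b -> exists u, [/\ A u, le u a, le u b
        & forall v, A v -> le v a -> le v b -> le v u]].

Section Divisibility.
Variable C : category.
Implicit Types f g h : mor C.

(* [ldiv f g] is [f <= g] and [rdiv h g] is [g >= h]; reversing an order does not
   affect whether it is a lattice. *)
Definition ldiv f g : Prop := exists h, composes f h g.
Definition rdiv h g : Prop := exists f, composes f h g.

Definition atom f : Prop :=
  ~ is_id f /\ forall g h, composes g h f -> is_id g \/ is_id h.

Definition homogeneous : Prop := exists l : mor C -> nat,
  (forall f g, tgt f = src g -> l (f ** g) = (l f + l g)%N) /\
  (forall f, l f = 0%N <-> is_id f).

Definition cancellative : Prop := forall a f g b,
  tgt a = src f -> tgt f = src b -> tgt a = src g -> tgt g = src b ->
  a ** f ** b = a ** g ** b -> f = g.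

Definition simple_for (Delta : C -> mor C) f : Prop :=
  exists g, composes f g (Delta (src f)).
End Divisibility.

Record garside := Garside {
  gcat :> category;
  phi : functor gcat gcat;
  phiV : functor gcat gcat;
  phi_obK : cancel (fob phi) (fob phiV);
  phiV_obK : cancel (fob phiV) (fob phi);
  phi_morK : cancel (fmor phi) (fmor phiV);
  phiV_morK : cancel (fmor phiV) (fmor phi);
  Delta : gcat -> mor gcat;
  src_Delta : forall x, src (Delta x) = x;
  tgt_Delta : forall x, tgt (Delta x) = phi x;
  Delta_nat : forall f, f ** Delta (tgt f) = Delta (src f) ** fmor phi f;
  garside_hom : homogeneous gcat;
  garside_cancel : cancellative gcat;
  garside_atom : forall f, atom f -> simple_for Delta f;
  garside_ldiv : forall x : gcat, is_lattice (fun f => src f = x) (@ldiv gcat);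
  garside_rdiv : forall x : gcat, is_lattice (fun f => tgt f = x) (@rdiv gcat) }.

Arguments phi {g}.
Arguments phiV {g}.
Arguments Delta {g} _.

Definition simple (G : garside) (f : mor G) : Prop := simple_for Delta f.

Definition cyclic (G : garside) : Prop := exists n : nat, (0 < n)%N /\
  (forall x : G, iter n (fob phi) x = x) /\
  (forall f : mor G, iter n (fmor phi) f = f).

Definition phi_pow (G : garside) (k : int) (f : mor G) : mor G :=
  match k with
  | Posz n => iter n (fmor phi) f
  | Negz n => iter n.+1 (fmor phiV) f
  end.

(* [D x ** D (F x) ** D (F (F x)) ** ...] with [n] factors *)
Definition Dpow (C : category) (F : C -> C) (D : C -> mor C) (x : C) (n : nat) :
  mor C := product x [seq D (iter i F x) | i <- iota 0 n].

(* The power [Delta ^ k] with source [x] in the Garside groupoid; for a negative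
   exponent it is the inverse of the power of [Delta] with target [x]. *)
Definition Delta_pow (G : garside) (x : G) (k : int) : mor (groupoid G) :=
  match k with
  | Posz n => emb (Dpow (fob phi) Delta x n)
  | Negz n => embV (Dpow (fob phi) Delta (iter n.+1 (fob phiV) x) n.+1)
  end.

(* The sequence of the morphisms [s_i = s ^ (phi ^ (- (i - 1) k))], 1 <= i <= q. *)
Definition twisted_powers (G : garside) (q : nat) (k : int) (s : mor G) :
  q.-tuple (mor G) := [tuple phi_pow (- (Posz i * k))%R s | i < q].

Definition periodic (G : garside) (p q : nat) (rho : mor (groupoid G)) : Prop :=
  src rho = tgt rho /\ power rho q = Delta_pow (src rho) (Posz p).

Section Divided.
Variables (G : garside) (m : nat).

Definition is_divided (f : m.-tuple (mor G)) : Prop :=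
  exists x : G, chain x f (phi x) /\ product x f = Delta x.

Record dobj := DObj { dval :> m.-tuple (mor G); dobjP : is_divided dval }.

(* [twist s] is [(s_2, ..., s_m, phi s_1)]; [ordS] is the cyclic successor. *)
Definition twist (s : m.-tuple (mor G)) : m.-tuple (mor G) :=
  [tuple if i.+1 == m then fmor phi (tnth s (ordS i)) else tnth s (ordS i)
    | i < m].

Definition is_dedge (f g s : m.-tuple (mor G)) : Prop := forall i : 'I_m,
  [/\ simple (tnth s i), src (tnth s i) = src (tnth f i),
      tgt (tnth s i) = src (tnth g i)
    & exists s', composes (tnth s i) s' (tnth f i) /\
                 composes s' (tnth (twist s) i) (tnth g i)].

Record dedge := DEdge {
  esrc : dobj; etgt : dobj; ecomp :> m.-tuple (mor G);
  dedgeP : is_dedge esrc etgt ecomp }.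

Definition div_quiver : quiver := @Quiver dobj dedge esrc etgt.

(* In [div_comp] the partial product of [e1] and [e2] is defined precisely because
   the componentwise product is an edge [e3]. *)
Inductive div_rel : seq (mor div_quiver) -> seq (mor div_quiver) -> Prop :=
| div_id (e : dedge) : esrc e = etgt e ->
    (forall i, is_id (tnth e i)) -> div_rel [:: e] [::]
| div_comp (e1 e2 e3 : dedge) : etgt e1 = esrc e2 ->
    esrc e3 = esrc e1 -> etgt e3 = etgt e2 ->
    (forall i, tnth e3 i = tnth e1 i ** tnth e2 i) ->
    div_rel [:: e1; e2] [:: e3].

Definition divided : category := presented div_rel.

Definition dgen (e : dedge) : mor divided := gen div_rel e.

End Divided.

Section GarsideTheory.
Variable G : garside.
Implicit Types (x y z : G) (f g h s t a b c : mor G).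

Lemma src_composes f g h : composes f g h -> src h = src f.
Proof. by case=> e <-; rewrite src_comp. Qed.

Lemma tgt_composes f g h : composes f g h -> tgt h = tgt g.
Proof. by case=> e <-; rewrite tgt_comp. Qed.

Lemma lcancel f g h : tgt f = src g -> tgt f = src h -> f ** g = f ** h -> g = h.
Proof.
move=> e1 e2 e.
have et : tgt g = tgt h by rewrite -(tgt_comp e1) e tgt_comp.
apply: (@garside_cancel G f g h (idm (tgt g))); rewrite ?src_id //.
by rewrite e.
Qed.

Lemma composes_inj f g g' h : composes f g h -> composes f g' h -> g = g'.
Proof. by case=> e1 e2 [e3 e4]; apply: (@lcancel f); rewrite ?e2. Qed.

Lemma composes_fmor f g h :
  composes f g h -> composes (fmor phi f) (fmor phi g) (fmor phi h).
Proof. by case=> e1 <-; split; [rewrite ftgt fsrc e1|rewrite fcomp]. Qed.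

Lemma composes_id1 f x : src f = x -> composes (idm x) f f.
Proof. by move=> <-; split; [rewrite tgt_id|rewrite comp1m]. Qed.

Lemma composes_id2 f x : tgt f = x -> composes f (idm x) f.
Proof. by move=> <-; split; [rewrite src_id|rewrite compm1]. Qed.

Lemma composes_mk f g : tgt f = src g -> composes f g (f ** g).
Proof. by []. Qed.

Lemma composesA f g h fg k :
  composes f g fg -> composes fg h k -> composes f (g ** h) k /\ tgt g = src h.
Proof.
move=> [e1 <-] [e2 <-]; have e3 : tgt g = src h by rewrite -e2 tgt_comp.
by split=> //; split; [rewrite src_comp|rewrite compA].
Qed.

Lemma ldiv_refl f : ldiv f f.
Proof. by exists (idm (tgt f)); apply: composes_id2. Qed.

Lemma ldiv_trans f g h : ldiv f g -> ldiv g h -> ldiv f h.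
Proof. by move=> [u hu] [v hv]; exists (u ** v); case: (composesA hu hv). Qed.

Lemma ldiv_src f g : ldiv f g -> src f = src g.
Proof. by case=> u /src_composes ->. Qed.

Definition lq f g : mor G :=
  if pselect (ldiv f g) is left h then projT1 (cid h) else g.

Lemma lqP f g : ldiv f g -> composes f (lq f g) g.
Proof. by move=> h; rewrite /lq; case: pselect => // h'; case: cid. Qed.

Lemma lq_eq f g h : composes f h g -> lq f g = h.
Proof. by move=> e; apply: (composes_inj (lqP _) e); exists h. Qed.

Lemma lqK f x : tgt f = x -> lq f f = idm x.
Proof. by move=> e; apply/lq_eq/composes_id2. Qed.

Lemma src_lq f g : ldiv f g -> src (lq f g) = tgt f.
Proof. by move/lqP=> []. Qed.

Lemma tgt_lq f g : ldiv f g -> tgt (lq f g) = tgt g.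
Proof. by move/lqP/tgt_composes. Qed.

Lemma lq_trans f g h :
  ldiv f g -> ldiv g h -> composes (lq f g) (lq g h) (lq f h).
Proof.
move=> /lqP h1 /lqP h2; have [h3 e] := composesA h1 h2.
by split=> //; rewrite (lq_eq h3).
Qed.

Lemma lq_mul u f g : tgt u = src f -> ldiv f g -> lq (u ** f) (u ** g) = lq f g.
Proof.
move=> e h; have [e1 e2] := lqP h; apply: lq_eq; split.
  by rewrite tgt_comp.
by rewrite -compA // e2.
Qed.

Lemma ldiv_mul u f g : tgt u = src f -> ldiv f g -> ldiv (u ** f) (u ** g).
Proof.
move=> e [h [e1 e2]]; exists h; split; first by rewrite tgt_comp.
by rewrite -compA // e2.
Qed.

Lemma simple_ldiv s x : src s = x -> simple s <-> ldiv s (Delta x).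
Proof. by move=> <-. Qed.

Lemma simple_id x : simple (idm x).
Proof.
by exists (Delta x); rewrite src_id; apply: composes_id1; rewrite src_Delta.
Qed.

Lemma simple_left f s : ldiv f s -> simple s -> simple f.
Proof.
move=> h hs; apply/(simple_ldiv (x := src s)); first exact: ldiv_src.
exact: ldiv_trans h hs.
Qed.

Lemma ldiv_Delta_nat f x : src f = x ->
  composes f (Delta (tgt f)) (Delta x ** fmor phi f).
Proof. by move=> <-; split; rewrite ?src_Delta // Delta_nat. Qed.

Lemma simple_lq f s : ldiv f s -> simple s -> simple (lq f s).
Proof.
move=> h [u hu]; have [e1 e2] := composesA (lqP h) hu.
have es : src s = src f by rewrite -(ldiv_src h).
exists (u ** fmor phi f); split.
  rewrite src_comp //; rewrite fsrc -(tgt_composes hu) tgt_Delta es //.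
have e3 : tgt u = src (fmor phi f).
  by rewrite fsrc -(tgt_composes hu) tgt_Delta es.
rewrite compA //; apply: (@lcancel f).
- by rewrite src_comp ?src_comp ?tgt_comp ?src_lq.
- by rewrite src_lq // src_Delta.
- rewrite src_lq // Delta_nat compA ?src_comp ?tgt_comp ?src_lq //.
  by case: e1 => _ ->; rewrite es.
Qed.

End GarsideTheory.

Lemma dobj_inj (G : garside) m (f g : dobj G m) :
  (forall i, tnth f i = tnth g i) -> f = g.
Proof.
case: f g => [f hf] [g hg] /= /eq_from_tnth e; subst g.
by congr DObj; apply: Prop_irrelevance.
Qed.

Lemma dedge_inj (G : garside) m (e e' : dedge G m) : esrc e = esrc e' ->
  etgt e = etgt e' -> (forall i, tnth e i = tnth e' i) -> e = e'.
Proof.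
case: e e' => [f g s h] [f' g' s' h'] /= e1 e2 /eq_from_tnth e3; subst.
by congr DEdge; apply: Prop_irrelevance.
Qed.

Section DividedDelta.
Variables (G : garside) (m : nat).

Lemma tnth_twist (s : m.-tuple (mor G)) (i : 'I_m) : tnth (twist s) i =
  if i.+1 == m then fmor phi (tnth s (ordS i)) else tnth s (ordS i).
Proof. by rewrite tnth_mktuple. Qed.

Lemma chain_rcons (C : category) (x y : C) l f :
  chain x l y -> src f = y -> chain x (rcons l f) (tgt f).
Proof.
by move=> h e; rewrite -cats1; apply: (chain_cat h); split.
Qed.

Lemma val_twist (f : mor G) (l : seq (mor G)) (s : m.-tuple (mor G)) :
  tval s = f :: l -> tval (twist s) = rcons l (fmor phi f).
Proof.
move=> es; have em : m = (size l).+1 by rewrite -(size_tuple s) es.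
apply: (@eq_from_nth _ f) => [|i]; first by rewrite size_tuple size_rcons em.
rewrite size_tuple => hi; have := tnth_twist s (Ordinal hi).
rewrite (tnth_nth f) /= => ->; rewrite (tnth_nth f) /= es.
rewrite nth_rcons; case: (ltngtP i (size l)) => hil.
- rewrite modn_small; last by rewrite em ltnS.
  by case: eqP => // e; move: hil; rewrite -ltnS -em e ltnn.
- by move: hi; rewrite em ltnS leqNgt hil.
- by rewrite hil -em eqxx modnn.
Qed.

Lemma twist_divided (f : m.-tuple (mor G)) :
  is_divided f -> is_divided (twist f).
Proof.
case=> x; case ef: (tval f) => [|f1 l] /=.
  case=> e1 e2; exists x.
  suff -> : tval (twist f) = [::] by [].
  by apply: size0nil; rewrite size_tuple -(size_tuple f) ef.
case=> -[<- h] e; exists (tgt f1); rewrite (val_twist ef).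
have h2 : chain (phi (src f1)) [:: fmor phi f1] (phi (tgt f1)).
  by split; rewrite ?fsrc ?ftgt.
have e3 : tgt (product (tgt f1) l) = src (fmor phi f1).
  by rewrite (tgt_product h) fsrc.
rewrite -cats1; split; first exact: (chain_cat h h2).
rewrite (product_cat h h2) product1.
have e1 : tgt f1 = src (product (tgt f1) l) by rewrite (src_product h).
apply: (@lcancel _ f1).
- by rewrite src_comp.
- by rewrite src_Delta.
- by rewrite compA // e Delta_nat.
Qed.

(* The automorphism [phi_m] is only needed on objects, to form the powers of
   [Delta_m]. *)
Definition dphi (f : dobj G m) : dobj G m := DObj (twist_divided (dobjP f)).

Lemma chain_nth (C : category) (x y : C) (l : seq (mor C)) d i :
  chain x l y -> (i.+1 < size l)%N -> tgt (nth d l i) = src (nth d l i.+1).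
Proof.
elim: l x i => [//|f l IH] x [|i] /= [_ h] hi; last exact: IH h hi.
by case: l h hi {IH} => [//|g l] /= [<-].
Qed.

Lemma chain_last (C : category) (x y : C) (l : seq (mor C)) d :
  chain x l y -> (0 < size l)%N -> tgt (nth d l (size l).-1) = y.
Proof.
elim: l x => [//|f l IH] x /= [_ h] _.
case: l h IH => [//|g l] /= h IH; exact: IH h isT.
Qed.

Lemma tgt_divided (f : m.-tuple (mor G)) (i : 'I_m) :
  is_divided f -> tgt (tnth f i) = src (tnth (twist f) i).
Proof.
case=> x [h _]; rewrite tnth_twist.
pose d := tnth f i; rewrite !(tnth_nth d) /=.
have hi := ltn_ord i; case: eqP => [e|/eqP e].
- rewrite e modnn fsrc.
  have -> : i = (size f).-1 :> nat by move/(congr1 predn): e; rewrite size_tuple.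
  have h0 : (0 < size f)%N by rewrite size_tuple (leq_trans _ hi).
  rewrite (chain_last _ h h0); congr (phi _).
  by case: (tval f) h h0 => [//|g l] /= [].
- have hi' : (i.+1 < m)%N by rewrite ltn_neqAle e.
  by rewrite modn_small //; apply: (chain_nth _ h); rewrite size_tuple.
Qed.

Lemma simple_factor (x y : G) l d i : chain x l y ->
  simple (product x l) -> (i < size l)%N -> simple (nth d l i).
Proof.
elim: l x i => [//|f l IH] x i /= [_ h] hs hi.
have hc : composes f (product (tgt f) l) (f ** product (tgt f) l).
  by split=> //; rewrite (src_product h).
have hd : ldiv f (f ** product (tgt f) l) by exists (product (tgt f) l).
case: i hi => [_|i hi] /=; first exact: simple_left hd hs.
by apply: (IH _ i h _ hi); rewrite -(lq_eq hc); apply: simple_lq.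
Qed.

Lemma simple_divided (f : m.-tuple (mor G)) (i : 'I_m) :
  is_divided f -> simple (tnth f i).
Proof.
case=> x [h e]; rewrite (tnth_nth (tnth f i)).
apply: (simple_factor _ h); last by rewrite size_tuple.
rewrite e; apply/(simple_ldiv (x := x)); first by rewrite src_Delta.
exact: ldiv_refl.
Qed.

Lemma dDelta_edge (f : dobj G m) : is_dedge f (dphi f) f.
Proof.
move=> i; have hf := dobjP f; split=> //; first exact: simple_divided.
  exact: tgt_divided.
exists (idm (tgt (tnth f i))); split; first exact: composes_id2.
by apply: composes_id1; rewrite tgt_divided.
Qed.

(* [Delta_m] at [f] is the edge [(f_1, ..., f_m)] from [f] to its image by
   [phi_m]. *)
Definition dDelta (f : dobj G m) : mor (divided G m) :=
  dgen (DEdge (dDelta_edge f)).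

Definition dDelta_pow (f : dobj G m) (n : nat) : mor (groupoid (divided G m)) :=
  emb (@Dpow (divided G m) dphi dDelta f n).

End DividedDelta.

(* For a simple morphism [s] with complement [s'], [A j] and [e j] are the
   objects and edges of the path [A 0 -> A 1 -> ... -> A m] defining the image
   of [s]; the [i]-th entry of a tuple is, counting from 1, its [i.+1]-th term. *)
Definition is_Theta (G : garside) (m : nat) (F : functor G (divided G m)) :
  Prop :=
  (forall (x : G) (i : 'I_m),
     tnth (fob F x : dobj G m) i = if i.+1 == m then Delta x else idm x) /\
  (forall s s' : mor G, composes s s' (Delta (src s)) ->
   exists (A : nat -> dobj G m) (e : nat -> dedge G m),
     [/\ A 0%N = fob F (src s) /\ A m = fob F (tgt s),
         forall j (i : 'I_m), (0 < j < m)%N ->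
           [/\ i.+1 = (m - j)%N -> tnth (A j) i = s,
               i.+1 = m -> tnth (A j) i = s'
             & i.+1 <> (m - j)%N -> i.+1 <> m -> is_id (tnth (A j) i)],
         forall j, (0 < j <= m)%N ->
           esrc (e j) = A j.-1 /\ etgt (e j) = A j,
         forall j (i : 'I_m), (0 < j <= m)%N ->
           (i.+1 = (m + 1 - j)%N -> tnth (e j) i = s) /\
           (i.+1 <> (m + 1 - j)%N -> is_id (tnth (e j) i))
       & fmor F s = product (fob F (src s)) [seq dgen (e j) | j <- iota 1 m]]).

Section SimplePresentation.
Variables (G : garside) (K : category) (TO : G -> K) (T : mor G -> mor K).
Hypothesis T_src : forall s, simple s -> src (T s) = TO (src s).
Hypothesis T_tgt : forall s, simple s -> tgt (T s) = TO (tgt s).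
Hypothesis T_id : forall x, T (idm x) = idm (TO x).
Hypothesis T_comp : forall s t, tgt s = src t -> simple s -> simple t ->
  simple (s ** t) -> T (s ** t) = T s ** T t.

Fixpoint simples (l : seq (mor G)) : Prop :=
  if l is f :: l' then simple f /\ simples l' else True.

Lemma simples_cat l l' : simples l -> simples l' -> simples (l ++ l').
Proof. by elim: l => //= f l IH [h1 h2] h3; split=> //; apply: IH. Qed.

Lemma simples_chain x l y :
  simples l -> chain x l y -> chain (TO x) (map T l) (TO y).
Proof.
elim: l x => [|f l IH] x /= => [_ -> //|[h1 h2] [<- h]].
by rewrite T_src // T_tgt //; split=> //; apply: IH.
Qed.

Lemma simple_dec (f : mor G) : exists l,
  [/\ chain (src f) l (tgt f), product (src f) l = f & simples l].
Proof.
have [len [lenM len0]] := garside_hom G.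
have [n] := ubnP (len f); elim: n f => // n IH f hn.
have [hid|hid] := pselect (is_id f).
  by exists [::]; rewrite hid /= src_id tgt_id.
have [hat|hat] := pselect (atom f).
  exists [:: f]; split=> //; first by rewrite product1.
  by split=> //; apply: garside_atom.
have [g [h [e hg hh]]] :
    exists g h, [/\ composes g h f, ~ is_id g & ~ is_id h].
  apply: contrapT => hn'; apply: hat; split=> // g h e.
  apply: contrapT => /not_orP [hg hh].
  by apply: hn'; exists g, h.
have [e1 e2] := e.
have lf : len f = (len g + len h)%N by rewrite -e2 lenM.
have lg : (0 < len g)%N by rewrite lt0n; apply/eqP => /len0.
have lh : (0 < len h)%N by rewrite lt0n; apply/eqP => /len0.
have [|l1 [c1 p1 s1]] := IH g.
  by rewrite -ltnS; apply: leq_trans hn; rewrite ltnS lf -addn1 leq_add2l.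
have [|l2 [c2 p2 s2]] := IH h.
  by rewrite -ltnS; apply: leq_trans hn; rewrite ltnS lf -add1n leq_add2r.
exists (l1 ++ l2); rewrite (src_composes e) (tgt_composes e).
rewrite e1 in c1; split; first exact: chain_cat c1 c2.
  by rewrite (product_cat c1 c2) p1 p2.
exact: simples_cat.
Qed.

Lemma simple_cong x y l l' : chain x l y -> chain x l' y ->
  simples l -> simples l' -> product x l = product x l' ->
  product (TO x) (map T l) = product (TO x) (map T l').
Proof.
have [len [lenM len0]] := garside_hom G.
have [n] := ubnP (len (product x l)); elim: n x y l l' => // n IHn x y l l'.
have [k] := ubnP (size l + size l'); elim: k x y l l' => // k IHk x y l l'.
move=> hk hn hl hl' sl sl' e.
case: l hl sl e hk hn => [|f l] hl sl e hk hn.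
  case: l' hl' sl' e hk => [//|g l'] hl' sl' e hk.
  have [hg hl1] := hl'; have [sg sl1] := sl'.
  have h1 : len (product x (g :: l')) = 0%N.
    by rewrite -e /=; apply/len0; rewrite /is_id src_id.
  have h2 : tgt g = src (product (tgt g) l') by rewrite (src_product hl1).
  move: h1; rewrite /= lenM // => /eqP; rewrite addn_eq0 => /andP [/eqP h3 _].
  move/len0: h3 => h3; have et : tgt g = x by rewrite h3 tgt_id hg.
  have hl2 : chain x l' y by rewrite -et.
  rewrite -[idm (TO x)]/(product (TO x) (map T [::])).
  rewrite (IHk x y [::] l') //; first last.
  - by rewrite e /= et {1}h3 hg -{1}(src_product hl2) comp1m.
  have hc := simples_chain sl1 hl1; rewrite et in hc.
  rewrite /= T_tgt // et h3 T_id hg -[in idm _](src_product hc).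
  by rewrite comp1m.
have [hf hl1] := hl; have [sf sl1] := sl.
have cf : composes f (product (tgt f) l) (product x (f :: l)).
  by split=> //; rewrite (src_product hl1).
have hlT := simples_chain sl1 hl1.
have [idf|idf] := pselect (is_id f).
  have et : tgt f = x by rewrite idf tgt_id hf.
  rewrite et in hlT hl1.
  have -> : product (TO x) (map T (f :: l)) = product (TO x) (map T l).
    rewrite /= T_tgt // et idf T_id hf -[in idm _](src_product hlT).
    by rewrite comp1m.
  have e' : product x (f :: l) = product x l.
    by rewrite /= et {1}idf hf -{1}(src_product hl1) comp1m.
  by apply: (IHk x y) => //; rewrite -e'.
case: l' hl' sl' e hk => [|g l'] hl' sl' e hk.
  have h1 : len (product x (f :: l)) = 0%N.
    by rewrite e /=; apply/len0; rewrite /is_id src_id.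
  case: cf => h2 h3; move: h1; rewrite /= lenM // => /eqP.
  by rewrite addn_eq0 => /andP [/eqP /len0].
have [hg hl1'] := hl'; have [sg sl1'] := sl'.
have cg : composes g (product (tgt g) l') (product x (f :: l)).
  by split=> //; rewrite ?(src_product hl1') // e.
have hlT' := simples_chain sl1' hl1'.
have [idg|idg] := pselect (is_id g).
  have et : tgt g = x by rewrite idg tgt_id hg.
  rewrite et in hlT' hl1'.
  have -> : product (TO x) (map T (g :: l')) = product (TO x) (map T l').
    rewrite /= T_tgt // et idg T_id hg -[in idm _](src_product hlT').
    by rewrite comp1m.
  have e' : product x (g :: l') = product x l'.
    by rewrite /= et {1}idg hg -{1}(src_product hl1') comp1m.
  apply: (IHk x y) => //; last by rewrite e e'.
  by move: hk; rewrite /= addnS ltnS.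
set F := product x (f :: l) in cf cg e hn *.
have srcF : src F = x by rewrite (src_product hl).
have tgtF : tgt F = y by rewrite (tgt_product hl).
have [_ _ _ joins _] := garside_ldiv x.
have [u [hu fu gu univ]] := joins f g hf hg.
have uF : ldiv u F.
  by apply: univ => //; [exists (product (tgt f) l)|exists (product (tgt g) l')].
have su : simple u.
  apply/(simple_ldiv hu); apply: univ; first by rewrite src_Delta.
    exact/simple_ldiv.
  exact/simple_ldiv.
have [h [eh1 eh2]] := uF.
have [lh [ch ph sh]] := simple_dec h.
have th : tgt h = y by rewrite -tgtF -eh2 tgt_comp.
have hT := simples_chain sh ch; rewrite th in ch hT.
suff key : forall f l, src f = x -> chain (tgt f) l y -> simple f ->
    simples l -> ~ is_id f -> ldiv f u -> composes f (product (tgt f) l) F ->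
    product (TO x) (map T (f :: l)) = T u ** product (TO (src h)) (map T lh).
  by rewrite (key f l) // (key g l').
clearbody F.
move=> {f l hl sl e hk hf hl1 sf sl1 cf hlT idf fu g l' hl' sl' hg hl1' sg sl1'
  cg hlT' idg gu univ uF IHk} f l hf hl sf sl idf fu [_ cf].
have [v1 v2] := lqP fu; set v := lq f u in v1 v2.
have sv : simple v by apply: simple_lq.
have tv : tgt v = src h by rewrite -eh1 -v2 tgt_comp.
have cv : chain (tgt f) (v :: lh) y by split=> //; rewrite tv.
have e' : product (tgt f) l = product (tgt f) (v :: lh).
  apply: (@lcancel _ f); rewrite ?(src_product hl) ?(src_product cv) //.
  by rewrite cf /= tv ph compA // v2.
have -> : product (TO x) (map T (f :: l)) =
    T f ** product (TO (tgt f)) (map T (v :: lh)).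
  rewrite /= T_tgt //; congr (_ ** _).
  apply: (IHn (tgt f) y l (v :: lh)) => //.
  have lf : (0 < len f)%N by rewrite lt0n; apply/eqP => /len0.
  rewrite -ltnS; apply: leq_trans hn; rewrite -cf lenM ?(src_product hl) //.
  by rewrite ltnS -add1n leq_add2r.
rewrite /= T_tgt // tv compA ?(src_product hT) ?T_src ?T_tgt //.
- by rewrite -v2 T_comp // v2.
- by rewrite v1.
- by rewrite tv.
Qed.

Lemma simple_functor : exists F : functor G K,
  fob F = TO /\ (forall s, simple s -> fmor F s = T s).
Proof.
pose dec f := projT1 (cid (simple_dec f)).
have decP f : [/\ chain (src f) (dec f) (tgt f), product (src f) (dec f) = f
    & simples (dec f)] by rewrite /dec; case: cid.
pose F f := product (TO (src f)) (map T (dec f)).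
have dchain f : chain (TO (src f)) (map T (dec f)) (TO (tgt f)).
  by case: (decP f) => c _ s; apply: simples_chain.
have Fsimple s : simple s -> F s = T s.
  move=> hs; case: (decP s) => c p sl.
  rewrite /F (simple_cong (y := tgt s) (l' := [:: s])) ?product1 //.
have Fid x : F (idm x) = idm (TO x).
  by rewrite Fsimple // ; apply: simple_id.
have Fcomp f g : tgt f = src g -> F (f ** g) = F f ** F g.
  move=> e; case: (decP f) => c1 p1 s1; case: (decP g) => c2 p2 s2.
  have h2 := dchain g; rewrite -e in c2 p2 h2.
  case: (decP (f ** g)); rewrite src_comp // tgt_comp // => c p s.
  have e' : product (src f) (dec (f ** g)) = product (src f) (dec f ++ dec g).
    by rewrite p (product_cat c1 c2) p1 p2.
  have := simple_cong c (chain_cat c1 c2) s (simples_cat s1 s2) e'.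
  rewrite map_cat (product_cat (dchain f) h2) {1}/F src_comp // => ->.
  by rewrite /F e.
exists (@Functor G K TO F (fun f => src_product (dchain f))
  (fun f => tgt_product (dchain f)) Fid Fcomp); split=> //.
Qed.
End SimplePresentation.

(* A family of simple morphisms with a common source,
   increasing for left divisibility, determines an object of the divided
   category whose terms are the successive quotients of the family. *)
Section ThetaConstruction.
Variables (G : garside) (m : nat).
Hypothesis m_gt0 : (0 < m)%N.

Record conf := Conf {
  cb : G;
  ca :> nat -> mor G;
  ca_src : forall p, (p < m)%N -> src (ca p) = cb;
  ca_simple : forall p, (p < m)%N -> simple (ca p);
  ca_mono : forall p, (p.+1 < m)%N -> ldiv (ca p) (ca p.+1) }.

Implicit Types a b c : conf.

Definition cwrap a : mor G := Delta (cb a) ** fmor phi (a 0%N).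

Definition cnext a (p : nat) : mor G := if p.+1 == m then cwrap a else a p.+1.

Lemma cwrap_composes a : composes (a 0%N) (Delta (tgt (a 0%N))) (cwrap a).
Proof. by apply/ldiv_Delta_nat/ca_src. Qed.

Lemma ldiv_Delta_cwrap a : ldiv (Delta (cb a)) (cwrap a).
Proof.
exists (fmor phi (a 0%N)); apply: composes_mk.
by rewrite tgt_Delta fsrc ca_src.
Qed.

Lemma ldiv_cwrap a s : src s = cb a -> simple s -> ldiv s (cwrap a).
Proof.
by move=> e /(simple_ldiv e) h; apply: ldiv_trans h (ldiv_Delta_cwrap a).
Qed.

Lemma cnext_div a p : (p < m)%N -> ldiv (a p) (cnext a p).
Proof.
move=> hp; rewrite /cnext; case: eqP => [e|/eqP e].
  by apply: ldiv_cwrap; [apply: ca_src|apply: ca_simple].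
by apply: ca_mono; rewrite ltn_neqAle e.
Qed.

Definition otup a : m.-tuple (mor G) := [tuple lq (a i) (cnext a i) | i < m].

Lemma tnth_otup a i : tnth (otup a) i = lq (a i) (cnext a i).
Proof. by rewrite tnth_mktuple. Qed.

Lemma telescope (b : nat -> mor G) k n :
  (forall p, (k <= p < k + n)%N -> ldiv (b p) (b p.+1)) ->
  chain (tgt (b k)) [seq lq (b p) (b p.+1) | p <- iota k n] (tgt (b (k + n)%N))
  /\ b k ** product (tgt (b k)) [seq lq (b p) (b p.+1) | p <- iota k n]
     = b (k + n)%N.
Proof.
elim: n k => [|n IH] k h; first by rewrite addn0 /= compm1.
have hk : ldiv (b k) (b k.+1) by apply: h; rewrite leqnn addnS ltnS leq_addr.
have [|h1 h2] := IH k.+1.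
  by move=> p /andP [h1 h2]; apply: h; rewrite (ltnW h1) addnS -addSn.
rewrite addnS -addSn /= src_lq // tgt_lq //; split=> //.
have [e1 e2] := lqP hk.
by rewrite compA ?e2 // (src_product h1) tgt_lq.
Qed.

Lemma otup_divided a : is_divided (otup a).
Proof.
pose b p := if p == m then cwrap a else a p.
have eb p : (p < m)%N -> b p = a p by move=> hp; rewrite /b ltn_eqF.
have en p : b p.+1 = cnext a p by [].
have hb : tval (otup a) = [seq lq (b p) (b p.+1) | p <- iota 0 m].
  rewrite /= -val_enum_ord -map_comp; apply: eq_map => i /=.
  by rewrite eb ?en.
have [|h1 h2] := @telescope b 0 m.
  by move=> p /= hp; rewrite eb // en; apply: cnext_div.
have bm : b m = cwrap a by rewrite /b eqxx.
rewrite add0n bm -hb (eb 0%N m_gt0) in h1 h2.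
have tw : tgt (cwrap a) = phi (tgt (a 0%N)).
  by rewrite tgt_comp ?ftgt // tgt_Delta fsrc ca_src.
rewrite tw in h1; exists (tgt (a 0%N)); split=> //.
apply: (@lcancel _ (a 0%N)); rewrite ?(src_product h1) ?src_Delta // h2.
by case: (cwrap_composes a).
Qed.

Definition O a : dobj G m := DObj (otup_divided a).

Definition step a b : Prop := cb a = cb b /\
  (forall p, (p < m)%N -> ldiv (a p) (b p) /\ ldiv (b p) (cnext a p)).

Definition etup a b : m.-tuple (mor G) := [tuple lq (a i) (b i) | i < m].

Lemma twist_etup a b i : step a b ->
  tnth (twist (etup a b)) i = lq (cnext a i) (cnext b i) /\
  ldiv (cnext a i) (cnext b i).
Proof.
case=> e h; rewrite tnth_twist tnth_mktuple /= /cnext.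
have hi := ltn_ord i; case: eqP => [e'|/eqP e'].
  rewrite e' modnn; have [/lqP h0 _] := h _ m_gt0.
  have := composes_fmor h0; rewrite /cwrap e => -[h1 h2].
  have hd : composes (Delta (cb b) ** fmor phi (a 0%N))
     (fmor phi (lq (a 0%N) (b 0%N))) (Delta (cb b) ** fmor phi (b 0%N)).
    have h3 : tgt (Delta (cb b)) = src (fmor phi (a 0%N)).
      by rewrite tgt_Delta fsrc ca_src // e.
    by split; [rewrite tgt_comp|rewrite -compA // h2].
  by rewrite (lq_eq hd); split=> //; eexists; apply: hd.
have hi' : (i.+1 < m)%N by rewrite ltn_neqAle e'.
by rewrite modn_small //; case: (h _ hi').
Qed.

Lemma edge_ok a b : step a b -> is_dedge (O a) (O b) (etup a b).
Proof.
move=> st i; have [e1 e2] := twist_etup i st; case: (st) => e h.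
have [h1 h2] := h _ (ltn_ord i).
have h3 := cnext_div a (ltn_ord i); have h4 := cnext_div b (ltn_ord i).
rewrite e1 !tnth_otup tnth_mktuple; split.
- by apply: simple_lq => //; apply: ca_simple.
- by rewrite !src_lq.
- by rewrite tgt_lq // src_lq.
exists (lq (b i) (cnext a i)); split; first exact: lq_trans.
exact: lq_trans.
Qed.

Definition E a b (st : step a b) : dedge G m := DEdge (edge_ok st).

Definition Emor a b : mor (divided G m) :=
  if pselect (step a b) is left st then dgen (E st)
  else idm (O a : divided G m).

Lemma EmorE a b (st : step a b) : Emor a b = dgen (E st).
Proof.
rewrite /Emor; case: pselect => // st'.
by congr (dgen (E _)); apply: Prop_irrelevance.
Qed.

Lemma src_Emor a b : step a b -> src (Emor a b) = O a.
Proof. by move=> st; rewrite (EmorE st); apply: src_gen. Qed.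

Lemma tgt_Emor a b : step a b -> tgt (Emor a b) = O b.
Proof. by move=> st; rewrite (EmorE st); apply: tgt_gen. Qed.

Lemma Emor_comp a b c : step a b -> step b c -> step a c ->
  Emor a b ** Emor b c = Emor a c.
Proof.
move=> s1 s2 s3; rewrite (EmorE s1) (EmorE s2) (EmorE s3).
have r : div_rel [:: E s1; E s2] [:: E s3].
  apply: div_comp => // i; rewrite !tnth_mktuple.
  have [h1 _] := s1.2 _ (ltn_ord i); have [h2 _] := s2.2 _ (ltn_ord i).
  by case: (lq_trans h1 h2).
have h1 : @chain (div_quiver G m) (O a) [:: E s1; E s2] (O c) by [].
have h2 : @chain (div_quiver G m) (O a) [:: E s3] (O c) by [].
by have /= := pres_rel r h1 h2; rewrite !compm1.
Qed.

Definition translate (u : mor G) a b : Prop :=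
  [/\ tgt u = cb b, src u = cb a & forall p, (p < m)%N -> a p = u ** b p].

Lemma cnext_translate u a b p :
  translate u a b -> (p < m)%N -> cnext a p = u ** cnext b p.
Proof.
case=> h1 h2 h3 hp; rewrite /cnext; case: eqP => [e|/eqP e]; last first.
  by apply: h3; rewrite ltn_neqAle e.
rewrite /cwrap h3 // -h2 -h1 fcomp ?ca_src //.
have hd : tgt (Delta (tgt u)) = src (fmor phi (b 0%N)).
  by rewrite tgt_Delta fsrc ca_src // h1.
rewrite compA ?tgt_Delta ?fsrc ?ftgt ?ca_src ?h1 // -h1 -Delta_nat.
by rewrite -compA // src_Delta.
Qed.

Lemma O_translate u a b : translate u a b -> O a = O b.
Proof.
move=> h; apply: dobj_inj => i; rewrite !tnth_otup.
have [h1 h2 h3] := h; rewrite (cnext_translate h) // h3 //.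
by apply: lq_mul; [rewrite ca_src|apply: cnext_div].
Qed.

Lemma Emor_translate u a b a' b' : translate u a a' -> translate u b b' ->
  step a b -> step a' b' -> Emor a b = Emor a' b'.
Proof.
move=> h h' s1 s2; rewrite (EmorE s1) (EmorE s2); congr dgen.
have [h1 h2 h3] := h; have [h1' h2' h3'] := h'.
apply: dedge_inj => [||i]; [exact: O_translate h|exact: O_translate h'|].
rewrite !tnth_mktuple h3 // h3' //; apply: lq_mul; first by rewrite ca_src.
by case: (s2.2 _ (ltn_ord i)).
Qed.

Definition PP (a : nat -> conf) n : mor (divided G m) :=
  product (O (a 0%N) : divided G m) [seq Emor (a i) (a i.+1) | i <- iota 0 n].

Lemma PP_chain (a : nat -> conf) k n :
  (forall i, (i < k + n)%N -> step (a i) (a i.+1)) ->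
  @chain (divided G m) (O (a k)) [seq Emor (a i) (a i.+1) | i <- iota k n]
    (O (a (k + n)%N)).
Proof.
elim: n k => [|n IH] k h; first by rewrite addn0.
have st : step (a k) (a k.+1) by apply: h; rewrite addnS ltnS leq_addr.
rewrite addnS -addSn /=; split; first exact: src_Emor.
by rewrite tgt_Emor //; apply: IH => i hi; apply: h; rewrite addnS -addSn.
Qed.

Lemma PPS (a : nat -> conf) n : (forall i, (i < n.+1)%N -> step (a i) (a i.+1)) ->
  PP a n.+1 = PP a n ** Emor (a n) (a n.+1).
Proof.
move=> h.
have e : iota 0 n.+1 = iota 0 n ++ [:: n] by rewrite -[n.+1]addn1 iotaD add0n.
rewrite /PP e map_cat.
have h1 := @PP_chain a 0 n (fun i hi => h i (ltnW hi)).
have h2 := @PP_chain a n 1.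
rewrite addn1 in h2; have {}h2 := h2 (fun i hi => h i hi).
by rewrite add0n in h1; rewrite (product_cat h1 h2) /= compm1.
Qed.

Lemma src_PP (a : nat -> conf) n : (forall i, (i < n)%N -> step (a i) (a i.+1)) ->
  src (PP a n) = O (a 0%N).
Proof. by move=> h; apply: (src_product (PP_chain (k := 0) h)). Qed.

Lemma tgt_PP (a : nat -> conf) n : (forall i, (i < n)%N -> step (a i) (a i.+1)) ->
  tgt (PP a n) = O (a n).
Proof. by move=> h; apply: (tgt_product (PP_chain (k := 0) h)). Qed.

Lemma PP_translate u (a b : nat -> conf) n :
  (forall i, (i < n)%N -> step (a i) (a i.+1) /\ step (b i) (b i.+1)) ->
  (forall i, translate u (a i) (b i)) -> PP a n = PP b n.
Proof.
move=> h ht; elim: n h => [|n IH] h.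
  by rewrite /PP /= (O_translate (ht 0%N)).
rewrite !PPS; [|by move=> i /h []..].
rewrite IH; last by move=> i hi; apply: h; apply: ltnW.
by congr (_ ** _); case: (h n) => // *; apply: Emor_translate.
Qed.

Section Levels.
Variables s t : mor G.
Hypothesis st : tgt s = src t.
Hypothesis hst : simple (s ** t).

Definition lvl_mor (i j p : nat) : mor G :=
  if (m - j <= p)%N then s ** t else if (m - i <= p)%N then s else idm (src s).

Let ds : ldiv s (s ** t). Proof. by exists t. Qed.
Let d1 f : src f = src s -> ldiv (idm (src s)) f.
Proof. by exists f; apply: composes_id1. Qed.
Let hs : simple s. Proof. exact: simple_left ds hst. Qed.

Lemma lvl_src i j p : src (lvl_mor i j p) = src s.
Proof.
by rewrite /lvl_mor; case: ifP => _; [rewrite src_comp|case: ifP => // _; rewrite src_id].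
Qed.

Lemma lvl_simple i j p : simple (lvl_mor i j p).
Proof.
rewrite /lvl_mor; case: ifP => _ //; case: ifP => _ //; exact: simple_id.
Qed.

Lemma lvl_ldiv i j p i' j' p' :
  ((m - i <= p) -> (m - i' <= p'))%N -> ((m - j <= p) -> (m - j' <= p'))%N ->
  ldiv (lvl_mor i j p) (lvl_mor i' j' p').
Proof.
rewrite /lvl_mor => hi hj; case: ifP => h1.
  by rewrite hj //; apply: ldiv_refl.
case: ifP => h2.
  by rewrite hi //; case: ifP => _ //; apply: ldiv_refl.
by apply: d1; apply: lvl_src.
Qed.

Definition L (i j : nat) : conf.
Proof.
refine (@Conf (src s) (lvl_mor i j) (fun p _ => lvl_src i j p)
  (fun p _ => lvl_simple i j p) _).
by move=> p _; apply: lvl_ldiv => h; apply: leq_trans h _.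
Defined.

Lemma L_step i j i' j' : (i <= i' <= i.+1)%N -> (j <= j' <= j.+1)%N ->
  step (L i j) (L i' j').
Proof.
move=> /andP [i1 i2] /andP [j1 j2]; split=> // p hp; split.
  by apply: lvl_ldiv => h; apply: leq_trans h; apply: leq_sub2l.
rewrite /cnext; case: eqP => [e|_].
  apply: ldiv_cwrap; [exact: lvl_src|exact: lvl_simple].
apply: lvl_ldiv => h; rewrite leq_subLR.
  by rewrite -[X in (_ <= X)%N]addSnnS; rewrite leq_subLR in h; apply: leq_trans h _; rewrite leq_add2r.
by rewrite -[X in (_ <= X)%N]addSnnS; rewrite leq_subLR in h; apply: leq_trans h _; rewrite leq_add2r.
Qed.

Let M (i j k l : nat) := Emor (L i j) (L k l).

Lemma L_comp i j i1 j1 i2 j2 : (i <= i1 <= i2)%N -> (j <= j1 <= j2)%N ->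
  (i2 <= i.+1)%N -> (j2 <= j.+1)%N ->
  M i j i1 j1 ** M i1 j1 i2 j2 = M i j i2 j2.
Proof.
move=> /andP [a1 a2] /andP [b1 b2] a3 b3; apply: Emor_comp; apply: L_step.
- by rewrite a1 (leq_trans a2).
- by rewrite b1 (leq_trans b2).
- by rewrite a2 (leq_trans a3).
- by rewrite b2 (leq_trans b3).
- by rewrite a3 (leq_trans a1).
- by rewrite b3 (leq_trans b1).
Qed.

Let Lcol i j : step (L i j) (L i j.+1).
Proof. by apply: L_step; rewrite ?leqnn ?leqnSn. Qed.
Let Lrow i j : step (L i j) (L i.+1 j).
Proof. by apply: L_step; rewrite ?leqnn ?leqnSn. Qed.
Let Ldiag i j : step (L i j) (L i.+1 j.+1).
Proof. by apply: L_step; rewrite ?leqnn ?leqnSn. Qed.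

Lemma grid_row n k :
  M n 0 n.+1 0 ** PP (L n.+1) k = PP (L n) k ** M n k n.+1 k.
Proof.
elim: k => [|k IH].
  rewrite /PP /= -[X in _ ** idm X](tgt_Emor (Lrow n 0)) compm1.
  by rewrite -[X in idm X](src_Emor (Lrow n 0)) comp1m.
have e1 : tgt (PP (L n.+1) k) = O (L n.+1 k) by apply: tgt_PP.
have e2 : src (PP (L n.+1) k) = O (L n.+1 0) by apply: src_PP.
have e3 : tgt (PP (L n) k) = O (L n k) by apply: tgt_PP.
rewrite !PPS // compA ?src_Emor ?tgt_Emor // IH.
rewrite -!compA ?src_Emor ?tgt_Emor //; congr (_ ** _).
rewrite -[Emor (L n.+1 k) _]/(M _ _ _ _) -[Emor (L n k) _]/(M _ _ _ _).
by rewrite !L_comp // ?leqnn ?leqnSn.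
Qed.

Lemma grid_diag n :
  PP (fun i => L i 0) n ** PP (L n) n = PP (fun i => L i i) n.
Proof.
elim: n => [|n IH].
  by rewrite /PP /= -[X in idm X ** _](@src_id (divided G m)) comp1m.
have a1 : tgt (PP (fun i => L i 0) n) = O (L n 0).
  by apply: (@tgt_PP (fun i => L i 0)).
have a2 : tgt (PP (L n.+1) n) = O (L n.+1 n) by apply: tgt_PP.
have a3 : src (PP (L n.+1) n) = O (L n.+1 0) by apply: src_PP.
have a4 : tgt (PP (L n) n) = O (L n n) by apply: tgt_PP.
have a5 : src (PP (L n) n) = O (L n 0) by apply: src_PP.
rewrite (PPS (a := fun i => L i 0)) // (PPS (a := L n.+1)) //.
rewrite (PPS (a := fun i => L i i)) // -IH.
have b1 := Lrow n 0; have b2 := Lcol n.+1 n; have b3 := Lrow n n.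
rewrite -!compA ?src_comp ?tgt_comp ?src_Emor ?tgt_Emor ?a1 ?a5 //.
congr (_ ** _); rewrite compA ?src_Emor ?tgt_Emor ?a3 ?a2 //.
rewrite -[Emor (L n 0) _]/(M n 0 n.+1 0) grid_row.
rewrite -compA ?src_Emor ?tgt_Emor ?a4 //; congr (_ ** _).
by rewrite -[LHS]/(M _ _ _ _ ** M _ _ _ _) L_comp ?leqnn ?leqnSn.
Qed.
End Levels.

Lemma comp_idid (x : G) : idm x ** idm x = idm x.
Proof. by have := comp1m (idm x); rewrite src_id. Qed.

Section Theta1.
Variable s : mor G.
Hypothesis hs : simple s.

Let st1 : tgt s = src (idm (tgt s)). Proof. by rewrite src_id. Qed.
Let hs1 : simple (s ** idm (tgt s)). Proof. by rewrite compm1. Qed.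

Definition A1 j : conf := L st1 hs1 j 0.

Lemma A1E j p : (p < m)%N -> A1 j p = if (m - j <= p)%N then s else idm (src s).
Proof. by move=> hp; rewrite /= /lvl_mor subn0 leqNgt hp. Qed.

Lemma A1_step j : step (A1 j) (A1 j.+1).
Proof. by apply: L_step; rewrite ?leqnn ?leqnSn. Qed.
End Theta1.

Definition TO (x : G) : divided G m := O (A1 (simple_id x) 0).

Definition T (s : mor G) : mor (divided G m) :=
  if pselect (simple s) is left hs then PP (A1 hs) m
  else idm (TO (src s)).

Lemma TE s (hs : simple s) : T s = PP (A1 hs) m.
Proof.
rewrite /T; case: pselect => // hs'.
by congr (PP (A1 _) _); apply: Prop_irrelevance.
Qed.

Lemma TO_start s (hs : simple s) : O (A1 hs 0) = TO (src s).
Proof.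
apply: (@O_translate (idm (src s))); split=> [||p hp].
- by rewrite tgt_id /= src_id.
- by rewrite src_id.
rewrite !A1E // subn0 leqNgt hp /= src_id.
by rewrite comp_idid.
Qed.

Lemma TO_end s (hs : simple s) : O (A1 hs m) = TO (tgt s).
Proof.
apply: (@O_translate s); split=> [||p hp].
- by rewrite /= src_id.
- by [].
by rewrite !A1E // subnn /= subn0 leqNgt hp /= src_id compm1.
Qed.

Lemma T_src s : simple s -> src (T s) = TO (src s).
Proof.
move=> hs; rewrite (TE hs) src_PP ?TO_start // => i _; exact: A1_step.
Qed.

Lemma T_tgt s : simple s -> tgt (T s) = TO (tgt s).
Proof.
move=> hs; rewrite (TE hs) tgt_PP ?TO_end // => i _; exact: A1_step.
Qed.

Lemma Emor_id a b : step a b -> O a = O b ->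
  (forall p, (p < m)%N -> a p = b p) -> Emor a b = idm (O a : divided G m).
Proof.
move=> h e hab; rewrite (EmorE h).
have r : div_rel [:: E h] [::].
  apply: div_id => // i; rewrite tnth_mktuple hab // (lqK (x := tgt (b i))) //.
  by rewrite /is_id src_id.
have h1 : @chain (div_quiver G m) (O a) [:: E h] (O a) by rewrite {2}e.
by have /= := pres_rel r h1; move/(_ erefl); rewrite compm1.
Qed.

Lemma T_id x : T (idm x) = idm (TO x).
Proof.
rewrite (TE (simple_id x)).
have h n p : (p < m)%N -> A1 (simple_id x) n p = idm x.
  by move=> hp; rewrite A1E // src_id if_same.
have e n n' : O (A1 (simple_id x) n) = O (A1 (simple_id x) n').
  apply: (@O_translate (idm x)); split=> [||p hp]; last first.
  - by rewrite !h // comp_idid.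
  - by rewrite /= src_id.
  - by rewrite /= tgt_id src_id.
suff key n : PP (A1 (simple_id x)) n = idm (TO x) by [].
elim: n => [|n IH] //.
rewrite PPS => [|i _]; last exact: A1_step.
rewrite IH Emor_id ?(e n 0%N) //; last by move=> p hp; rewrite !h.
  by rewrite -[X in idm X ** _](@src_id (divided G m)) comp1m.
exact: A1_step.
Qed.

Lemma T_comp s t : tgt s = src t -> simple s -> simple t ->
  simple (s ** t) -> T (s ** t) = T s ** T t.
Proof.
move=> e hs ht hst; rewrite (TE hs) (TE ht) (TE hst).
have e1 : PP (A1 hs) m = PP (fun i => L e hst i 0) m.
  apply: (@PP_translate (idm (src s))) => [i _|i].
    by split; [exact: A1_step|apply: L_step; rewrite ?leqnn ?leqnSn].
  split=> [||p hp]; rewrite ?src_id ?tgt_id //.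
  rewrite A1E //= /lvl_mor subn0 [(m <= p)%N]leqNgt hp /=.
  case: ifP => _; first by rewrite comp1m.
  by rewrite comp_idid.
have e2 : PP (A1 ht) m = PP (L e hst m) m.
  symmetry; apply: (@PP_translate s) => [i _|i].
    by split; [apply: L_step; rewrite ?leqnn ?leqnSn|exact: A1_step].
  split=> [||p hp]; rewrite ?src_id ?tgt_id //.
  rewrite A1E //= /lvl_mor subnn leq0n.
  by case: ifP => _ //; rewrite -e compm1.
have e3 : PP (A1 hst) m = PP (fun i => L e hst i i) m.
  apply: (@PP_translate (idm (src s))) => [i _|i].
    by split; [exact: A1_step|apply: L_step; rewrite ?leqnn ?leqnSn].
  have es : src (s ** t) = src s by rewrite src_comp.
  split=> [||p hp]; rewrite ?src_id ?tgt_id //.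
  rewrite A1E //= /lvl_mor es.
  case: ifP => _; first by rewrite -[X in idm X]es comp1m.
  by rewrite comp_idid.
by rewrite e1 e2 e3 grid_diag.
Qed.

Lemma Theta_exists : exists F : functor G (divided G m), is_Theta F.
Proof.
have [F [FO FT]] := simple_functor T_src T_tgt T_id T_comp.
exists F; rewrite /is_Theta FO; split.
  move=> x i; rewrite tnth_otup /cnext /cwrap.
  have h p : (p < m)%N -> A1 (simple_id x) 0 p = idm x.
    by move=> hp; rewrite A1E // src_id if_same.
  rewrite (h i) // (h 0%N) //; case: (i.+1 =P m) => [_|/eqP e]; last first.
    rewrite h; first by rewrite (lqK (x := x)) // tgt_id.
    by rewrite ltn_neqAle e ltn_ord.
  rewrite /= src_id fid -tgt_Delta compm1.
  by apply/lq_eq/composes_id1; rewrite src_Delta.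
move=> s s' hc.
have hs : simple s by exists s'.
exists (fun j => O (A1 hs j)), (fun j => E (A1_step hs j.-1)).
split.
- by rewrite TO_start TO_end.
- move=> j i /andP [j0 jm]; rewrite tnth_otup /cnext A1E //.
  have hi := ltn_ord i.
  have a0 : A1 hs j 0 = idm (src s).
    by rewrite A1E // leqn0 subn_eq0 leqNgt jm.
  split.
  + move=> e; have hi' : (i.+1 < m)%N.
      by rewrite e ltn_subrL j0 (leq_trans _ hi).
    rewrite (ltn_eqF hi') A1E // -e ltnn leqnn.
    by apply/lq_eq/composes_id1.
  + move=> e; rewrite e eqxx /cwrap a0 fid /= -tgt_Delta compm1.
    have -> : (m - j <= i)%N.
      by rewrite -ltnS e ltn_subrL j0 (leq_trans _ hi).
    exact: lq_eq.
  + move=> n1 n2; have /negbTE -> : i.+1 != m by apply/eqP.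
    have hi' : (i.+1 < m)%N by rewrite ltn_neqAle hi andbT; apply/eqP.
    rewrite A1E //.
    have -> : (m - j <= i.+1)%N = (m - j <= i)%N.
      rewrite [LHS]leq_eqVlt ltnS; case: eqP => // e; by case: n1.
    by case: ifP => _; rewrite (lqK erefl) /is_id src_id.
- by move=> [|j] // _.
- move=> [|j] i // hj; rewrite tnth_mktuple -[j.+1.-1]/j !A1E // addn1 subSS subnS.
  have [h1 h2] : (m - j).-1.+1 = (m - j)%N /\ (0 < m - j)%N.
    by rewrite prednK subn_gt0.
  split=> [e|n].
    rewrite -e ltnn /= leqnn; exact/lq_eq/composes_id1.
  have -> : ((m - j).-1 <= i)%N = (m - j <= i)%N.
    rewrite leq_eqVlt -[((m - j).-1 < i)%N]ltnS -ltnS h1.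
    case: eqP => // e; case: n; by rewrite -e.
  by case: ifP => _; rewrite (lqK erefl) /is_id src_id.
- rewrite FT // (TE hs) /PP TO_start; congr product.
  rewrite (iotaDl 1 0) -map_comp; apply: eq_map => j /=.
  by rewrite (EmorE (A1_step hs j)).
Qed.
End ThetaConstruction.

(* Simple morphisms generate [G], so [is_Theta] characterizes this functor. *)
Definition Theta (G : garside) (m : nat) (m_gt0 : (0 < m)%N) :
  functor G (divided G m) := projT1 (cid (Theta_exists G m_gt0)).

Lemma ThetaP (G : garside) (m : nat) (m_gt0 : (0 < m)%N) :
  is_Theta (Theta G m_gt0).
Proof. by rewrite /Theta; case: cid. Qed.

Definition gTheta (G : garside) (m : nat) (m_gt0 : (0 < m)%N) :
  functor (groupoid G) (groupoid (divided G m)) :=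
  groupoid_functor (Theta G m_gt0).

(* Main.v *)
From mathcomp Require Import all_boot ssralg ssrnum ssrint.
From mathcomp Require Import boolp zify.
Require Import Defs.

Set Implicit Arguments.
Unset Strict Implicit.
Unset Printing Implicit Defensive.

Local Open Scope cat_scope.

(** An object of the [q]-divided category can be seen as a configuration: simple
    morphisms [a_0 <= ... <= a_(q-1)] with a common source, prolonged by
    [a_(i+q) = Delta (phi a_i)] and taken up to change of origin, that is, up
    to left translation; its terms are the successive quotients. In this model
    everything in the statement becomes visible.
    - Two configurations with [a_i <= b_i] for all [i] are joined by a canonical
      morphism [canon], which is functorial ([canon_comp]), invariant under
      translation ([canon_translate]), and equal to the edge from [a] to [b] when
      there is one ([canon_step]).
    - The functor Theta sends an object [x] to the constant configuration
      [1_x], and a simple [s] to the canonical morphism from the constant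
      configuration [1] to the constant configuration [s] ([Theta_canon]).
    - The Garside element of the divided category is the shift
      [a_i |-> a_(i+1)] ([cshiftE]). Starting from [1_x], it introduces one more
      entry [Delta] each time, so Theta maps [Delta] to [Delta_q ^ q]
      ([Theta_Delta]).

    Let [s : x -> y] and suppose that [k = n >= 0] and [p = q n + 1]. As [rho]
    is a loop, [phi ^ n] maps [y] to [x] and [s_(i+1)] to [s_i]. The object
    [(s_1, ..., s_q)] is the configuration [a_i = s_1 ... s_i] at [x], and its
    image by the shift, [b_i = s_1 ... s_(i+1)], is the translate by [s] of
    [a'_i = s_2 ... s_(i+1)] at [y], which [phi ^ n] maps to [a]. Take for [c]
    the canonical morphism from [1_x] to [a], and for [c'] the one from [1_y] to
    [a']. The two ways from [1_x] to [b], through the constant configuration [s]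
    and through [a], give [Theta(s) c' = c Delta_q] ([Theta_conj_tail]). Since
    [c] is the image of [c'] by the [q n]-th power of the automorphism of the
    divided category ([conj_mor_Phi]), the naturality of [Delta_q] yields
    [Theta(s Delta ^ n) c = Theta(s) c' Delta_q ^ (q n) = c Delta_q ^ (q n + 1)]
    ([Theta_conj]).

    The relation between [p] and [k] comes from a length on the groupoid that
    is invariant under [phi] ([periodic_exponent]). It fails to determine [p]
    only when [Delta_x] is an identity, and then all the morphisms in sight are
    identities. *)

(** * Powers of a natural transformation *)

Lemma fmor_iter_comp (C : category) (F : functor C C) n f g : tgt f = src g ->
  iter n (fmor F) (f ** g) = iter n (fmor F) f ** iter n (fmor F) g.
Proof.
move=> e; have [h1 h2] : iter n (fmor F) (f ** g) =
    iter n (fmor F) f ** iter n (fmor F) g /\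
    tgt (iter n (fmor F) f) = src (iter n (fmor F) g).
  elim: n => [|n [IH1 IH2]] //; rewrite !iterS IH1 fcomp //; split=> //.
  by rewrite fsrc ftgt IH2.
by [].
Qed.

Lemma fmor_iter_id (C : category) (F : functor C C) n x :
  iter n (fmor F) (idm x) = idm (iter n (fob F) x).
Proof. by elim: n => //= n ->; rewrite fid. Qed.

Section Dpow.
Variables (C : category) (F : C -> C) (D : C -> mor C).
Hypothesis src_D : forall x, src (D x) = x.
Hypothesis tgt_D : forall x, tgt (D x) = F x.

Lemma DpowS x n : Dpow F D x n.+1 = D x ** Dpow F D (F x) n.
Proof.
rewrite /Dpow /= tgt_D (iotaDl 1 0) -map_comp; congr (_ ** product _ _).
by apply: eq_map => i; rewrite /= -iterS iterSr.
Qed.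

Lemma src_Dpow x n : src (Dpow F D x n) = x.
Proof.
elim: n x => [|n IH] x; first by rewrite src_id.
by rewrite DpowS src_comp ?src_D ?tgt_D ?IH.
Qed.

Lemma tgt_Dpow x n : tgt (Dpow F D x n) = iter n F x.
Proof.
elim: n x => [|n IH] x; first by rewrite tgt_id.
by rewrite DpowS iterSr tgt_comp ?IH ?tgt_D ?src_Dpow.
Qed.

Lemma DpowD x n n' :
  Dpow F D x (n + n') = Dpow F D x n ** Dpow F D (iter n F x) n'.
Proof.
elim: n x => [|n IH] x.
  by have := comp1m (Dpow F D x n'); rewrite src_Dpow add0n => {1}<-.
rewrite addSn !DpowS IH -iterSr compA //; first by rewrite tgt_D src_Dpow.
by rewrite tgt_Dpow src_Dpow iterSr.
Qed.
End Dpow.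

Lemma Dpow_id (C : category) (F : C -> C) (D : C -> mor C) x n :
  F x = x -> D x = idm x -> Dpow F D x n = idm x.
Proof.
move=> hF hD; have hi i : iter i F x = x by elim: i => //= i ->.
have h1 := comp1m (idm x); rewrite src_id in h1.
rewrite /Dpow; elim: n 0%N => [|n IH] i //=.
by rewrite hi hD tgt_id IH.
Qed.

Section DpowNatural.
Variables (C : category) (F : functor C C) (D : C -> mor C).
Hypothesis src_D : forall x, src (D x) = x.
Hypothesis tgt_D : forall x, tgt (D x) = F x.
Hypothesis D_nat : forall c, c ** D (tgt c) = D (src c) ** fmor F c.

Lemma Dpow_nat c n : c ** Dpow (fob F) D (tgt c) n =
  Dpow (fob F) D (src c) n ** iter n (fmor F) c.
Proof.
elim: n c => [|n IH] c; first by rewrite /Dpow /= compm1 comp1m.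
rewrite !DpowS // compA ?src_D ?tgt_D ?src_Dpow //.
rewrite D_nat -compA ?tgt_D ?fsrc ?ftgt ?src_Dpow //.
rewrite -ftgt IH fsrc compA ?tgt_D ?src_Dpow // -?iterSr //.
rewrite tgt_Dpow //; elim: n {IH} => [|n IH]; first by rewrite fsrc.
by rewrite iterS IH -fsrc -iterS.
Qed.
End DpowNatural.

(** * The automorphism of the divided category *)

Section Phi.
Variable G : garside.
Implicit Types f g s : mor G.

Lemma phi_Delta (x : G) : fmor phi (Delta x) = Delta (phi x).
Proof.
have := Delta_nat (Delta x); rewrite src_Delta tgt_Delta => h.
by symmetry; apply: (lcancel _ _ h); rewrite ?fsrc ?src_Delta ?tgt_Delta.
Qed.

Lemma simple_phi s : simple s -> simple (fmor phi s).
Proof.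
by case=> u /composes_fmor; rewrite phi_Delta -fsrc; exists (fmor phi u).
Qed.

Lemma ldiv_phi f g : ldiv f g -> ldiv (fmor phi f) (fmor phi g).
Proof. by case=> u /composes_fmor h; exists (fmor phi u). Qed.

Lemma phi_lq f g : ldiv f g -> fmor phi (lq f g) = lq (fmor phi f) (fmor phi g).
Proof. by move/lqP/composes_fmor/lq_eq. Qed.
End Phi.

Section DividedPhi.
Variables (G : garside) (m : nat).
Implicit Types (f g : dobj G m) (e : dedge G m).

Lemma src_dgen e : src (dgen e) = esrc e. Proof. exact: src_gen. Qed.
Lemma tgt_dgen e : tgt (dgen e) = etgt e. Proof. exact: tgt_gen. Qed.

Lemma dgen_comp e1 e2 e3 : etgt e1 = esrc e2 -> esrc e3 = esrc e1 ->
  etgt e3 = etgt e2 -> (forall i, tnth e3 i = tnth e1 i ** tnth e2 i) ->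
  dgen e1 ** dgen e2 = dgen e3.
Proof.
move=> h1 h2 h3 h; have r := div_comp h1 h2 h3 h.
have c1 : @chain (div_quiver G m) (esrc e1) [:: e1; e2] (etgt e2) by [].
have c2 : @chain (div_quiver G m) (esrc e1) [:: e3] (etgt e2) by [].
by have /= := pres_rel r c1 c2; rewrite !compm1.
Qed.

Lemma dgen_id e : esrc e = etgt e -> (forall i, is_id (tnth e i)) ->
  dgen e = idm (esrc e : divided G m).
Proof.
move=> h1 h2; have r := div_id h1 h2.
have c1 : @chain (div_quiver G m) (esrc e) [:: e] (esrc e) by [].
by have /= := pres_rel r c1; move/(_ erefl); rewrite compm1.
Qed.

Lemma complement_dedge e :
  is_dedge (etgt e) (dphi (esrc e)) [tuple lq (tnth e i) (tnth (esrc e) i) | i < m].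
Proof.
have tw i : composes (tnth (twist e) i)
    (tnth (twist [tuple lq (tnth e i) (tnth (esrc e) i) | i < m]) i)
    (tnth (twist (esrc e)) i).
  rewrite !tnth_twist tnth_mktuple; have [_ _ _ [s' [h _]]] := dedgeP e (ordS i).
  by rewrite (lq_eq h); case: ifP => _ //; apply: composes_fmor.
move=> i; rewrite tnth_mktuple.
have [h1 h2 h3 [s' [c1 c2]]] := dedgeP e i; rewrite (lq_eq c1); split.
- rewrite -(lq_eq c1); apply: simple_lq; first by exists s'.
  exact: simple_divided (dobjP _).
- by case: c1 => <-.
- by rewrite -(tgt_composes c1); apply: tgt_divided (dobjP _).
by exists (tnth (twist e) i).
Qed.

Lemma twist_dedge e : is_dedge (dphi (esrc e)) (dphi (etgt e)) (twist e).
Proof.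
move=> i; have [h1 h2 h3 [s' [c1 c2]]] := dedgeP e (ordS i).
rewrite [tnth (twist e) i]tnth_twist !(tnth_twist (esrc e), tnth_twist (etgt e)) /=.
have -> : tnth (twist (twist e)) i = if i.+1 == m
  then fmor phi (tnth (twist e) (ordS i)) else tnth (twist e) (ordS i).
  by rewrite tnth_twist.
case: ifP => _; last by split=> //; exists s'.
split; rewrite ?fsrc ?ftgt ?h2 ?h3 //; first exact: simple_phi.
by exists (fmor phi s'); split; apply: composes_fmor.
Qed.

Definition complement_edge e : dedge G m := DEdge (complement_dedge e).
Definition twist_edge e : dedge G m := DEdge (twist_dedge e).

Lemma Phi_src e : src (dgen (twist_edge e)) = dphi (esrc e).
Proof. exact: src_dgen. Qed.

Lemma Phi_tgt e : tgt (dgen (twist_edge e)) = dphi (etgt e).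
Proof. exact: tgt_dgen. Qed.

Lemma Phi_rel (x y : div_quiver G m) a b : div_rel a b ->
  chain x a y -> chain x b y ->
  product (dphi x : divided G m) [seq dgen (twist_edge e) | e <- a] =
  product (dphi x : divided G m) [seq dgen (twist_edge e) | e <- b].
Proof.
case=> [e h1 h2|e1 e2 e3 h1 h2 h3 h] /=.
  move=> [<- _] _; rewrite compm1; apply: dgen_id => [|i]; first by rewrite /= h1.
  rewrite tnth_twist; case: ifP => _ //.
  by rewrite /is_id fsrc -fid; congr (fmor _ _); apply: h2.
move=> [_ [_ _]] [_ _]; rewrite !compm1.
apply: dgen_comp => /=; rewrite ?h1 ?h2 ?h3 // => i.
rewrite !tnth_twist h; case: ifP => _ //; rewrite fcomp //.
have [_ _ -> _] := dedgeP e1 (ordS i); have [_ -> _ _] := dedgeP e2 (ordS i).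
by rewrite h1.
Qed.

Definition Phi : functor (divided G m) (divided G m) :=
  @Defs.lift (div_quiver G m) _ (divided G m) (@dphi G m) (fun e => dgen (twist_edge e))
    Phi_src Phi_tgt Phi_rel.

Lemma Phi_dgen e : fmor Phi (dgen e) = dgen (twist_edge e).
Proof. exact: lift_gen. Qed.

Lemma iter_Phi_dgen n e :
  iter n (fmor Phi) (dgen e) = dgen (iter n twist_edge e).
Proof. by elim: n => // n IH; rewrite !iterS IH Phi_dgen. Qed.

Lemma src_dDelta f : src (dDelta f) = f. Proof. exact: src_dgen. Qed.
Lemma tgt_dDelta f : tgt (dDelta f) = dphi f. Proof. exact: tgt_dgen. Qed.

Lemma dDelta_factor_src e : dgen e ** dgen (complement_edge e) = dDelta (esrc e).
Proof.
apply: dgen_comp => //= i; rewrite tnth_mktuple.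
have [_ _ _ [s' [c _]]] := dedgeP e i.
by case: (lqP (f := tnth e i) (g := tnth (esrc e) i)) => //; exists s'.
Qed.

Lemma dDelta_factor_tgt e :
  dgen (complement_edge e) ** dgen (twist_edge e) = dDelta (etgt e).
Proof.
apply: dgen_comp => //= i; rewrite tnth_mktuple.
by have [_ _ _ [s' [c1 [_ c2]]]] := dedgeP e i; rewrite (lq_eq c1).
Qed.

(** An edge [e : f -> g] has a complement [e' : g -> phi_m f], made of the
    quotients of the [f_i] by the [e_i], and [Delta_f = e e'] while
    [Delta_g = e' (phi_m e)]. Hence [e Delta_g = e e' (phi_m e) = Delta_f (phi_m e)],
    and edges generate. *)
Lemma dDelta_nat (c : mor (divided G m)) :
  c ** dDelta (tgt c) = dDelta (src c) ** fmor Phi c.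
Proof.
elim/pres_ind: c => x l y.
rewrite -[product _ _]/(product (x : divided G m) (map (@dgen G m) l)).
elim: l x => [|e l IH] x.
  move=> _; rewrite -[product _ _]/(@idm (divided G m) x) src_id tgt_id fid.
  rewrite -[fob Phi x]/(dphi x) -(tgt_dDelta x) compm1.
  by have := comp1m (dDelta x); rewrite src_dDelta.
case=> hx h; have {}IH := IH _ h.
rewrite -[product _ _]/(dgen e ** product (tgt (dgen e)) (map (@dgen G m) l)).
rewrite tgt_dgen.
have sw := @chain_map (div_quiver G m) (divided G m) id (@dgen G m)
  src_dgen tgt_dgen _ _ _ h.
have {}sw := src_product sw.
rewrite -[tgt e]/(etgt e) in sw IH.
set w := product _ _ in IH sw *.
have ew : tgt (dgen e) = src w by rewrite tgt_dgen sw.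
rewrite src_comp // tgt_comp // -compA ?src_dDelta // IH sw fcomp // Phi_dgen.
rewrite -dDelta_factor_tgt src_dgen -dDelta_factor_src.
have h1 : tgt (dgen e) = src (dgen (complement_edge e)).
  by rewrite tgt_dgen src_dgen.
have h2 : tgt (dgen (complement_edge e)) = src (dgen (twist_edge e)).
  by rewrite tgt_dgen src_dgen.
have h3 : tgt (dgen (twist_edge e)) = src (fmor Phi w).
  by rewrite tgt_dgen fsrc sw.
by rewrite -!compA ?src_comp ?h1 ?h2 ?h3.
Qed.

(* Each twist moves the entries one place to the left; an entry leaving on the
   left comes back on the right transformed by [phi]. So after [m] twists each
   entry is back in place and has met [phi] once. *)
Lemma iter_twist (s : m.-tuple (mor G)) n (i l : 'I_m) :
  ((i + n)%N = l -> tnth (iter n (@twist G m) s) i = tnth s l) /\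
  ((i + n)%N = (l + m)%N ->
     tnth (iter n (@twist G m) s) i = fmor phi (tnth s l)).
Proof.
have hm : (0 < m)%N by apply: leq_trans (ltn_ord i).
elim: n i => [|n IH] i.
  rewrite addn0; split=> [/ord_inj -> //|e].
  by have := ltn_ord i; rewrite e ltnNge leq_addl.
have [IH1 IH2] := IH (ordS i).
rewrite iterS tnth_twist addnS -addSn; case: eqP => [e|/eqP e].
  have o0 : ordS i = 0%N :> nat by rewrite /= e modnn.
  split=> [el|el]; first by have := ltn_ord l; rewrite -el e ltnNge leq_addr.
  by rewrite IH1 // o0; move: el; rewrite e addnC => /addIn.
have hi : (i.+1 < m)%N by rewrite ltn_neqAle e ltn_ord.
by rewrite /= modn_small // in IH1 IH2.
Qed.

Lemma tnth_iter_twist (s : m.-tuple (mor G)) i :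
  tnth (iter m (@twist G m) s) i = fmor phi (tnth s i).
Proof. by apply: (iter_twist s m i i).2. Qed.

Lemma tnth_iter_dphi f i : tnth (iter m (@dphi G m) f) i = fmor phi (tnth f i).
Proof.
have h n : dval (iter n (@dphi G m) f) = iter n (@twist G m) f.
  by elim: n => //= n ->.
by rewrite h tnth_iter_twist.
Qed.

Lemma iter_twist_edge e :
  [/\ esrc (iter m twist_edge e) = iter m (@dphi G m) (esrc e),
      etgt (iter m twist_edge e) = iter m (@dphi G m) (etgt e)
    & forall i, tnth (iter m twist_edge e) i = fmor phi (tnth e i)].
Proof.
have h n : [/\ esrc (iter n twist_edge e) = iter n (@dphi G m) (esrc e),
    etgt (iter n twist_edge e) = iter n (@dphi G m) (etgt e)
  & ecomp (iter n twist_edge e) = iter n (@twist G m) e].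
  by elim: n => //= n [-> -> ->].
by have [-> -> ->] := h m; split=> // i; apply: tnth_iter_twist.
Qed.
End DividedPhi.

Arguments Phi {G m}.

(** * Canonical morphisms between configurations *)

Section Canonical.
Variables (G : garside) (m : nat).
Hypothesis m_gt0 : (0 < m)%N.
Implicit Types a b c : conf G m.

(** Only the indices below [m] matter: the values of a configuration at the
    other ones are junk. *)
Definition cle a b : Prop :=
  cb a = cb b /\ forall p, (p < m)%N -> ldiv (a p) (b p).

Lemma cle_refl a : cle a a.
Proof. by split=> // p _; apply: ldiv_refl. Qed.

Lemma step_cle a b : step a b -> cle a b.
Proof. by case=> e h; split=> // p hp; case: (h p hp). Qed.

Section Mix.
Variables a b c : conf G m.
Hypotheses (ab : cle a b) (bc : cle b c).

Definition mix_mor (i j p : nat) : mor G :=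
  if (m - j <= p)%N then c p else if (m - i <= p)%N then b p else a p.

Lemma mix_src i j p : (p < m)%N -> src (mix_mor i j p) = cb a.
Proof.
move=> hp; rewrite /mix_mor; case: ab bc => e1 _ [e2 _].
by case: ifP => _; [|case: ifP => _]; rewrite ca_src ?e1 ?e2.
Qed.

Lemma mix_simple i j p : (p < m)%N -> simple (mix_mor i j p).
Proof.
move=> hp; rewrite /mix_mor.
by case: ifP => _; [|case: ifP => _]; apply: ca_simple.
Qed.

Lemma mix_le i j p i' j' p' : p' = p \/ p' = p.+1 -> (p' < m)%N ->
  ((m - i <= p) -> (m - i' <= p'))%N -> ((m - j <= p) -> (m - j' <= p'))%N ->
  ldiv (mix_mor i j p) (mix_mor i' j' p').
Proof.
move=> hpp hp' hi hj; have hp : (p < m)%N.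
  by case: hpp hp' => -> //; apply: ltnW.
have mono (d : conf G m) : ldiv (d p) (d p').
  case: hpp hp' => -> h; [exact: ldiv_refl|exact: ca_mono].
have dab := ab.2 _ hp'; have dbc := bc.2 _ hp'.
rewrite /mix_mor; case: ifP => h1; first by rewrite hj.
case: ifP => h2.
  rewrite hi //; case: ifP => _ //; exact: ldiv_trans dbc.
case: ifP => _; first by apply: ldiv_trans dbc; apply: ldiv_trans dab.
case: ifP => _ //; exact: ldiv_trans dab.
Qed.

(** For [a <= b <= c], the grid of the [mix i j] contains the canonical paths
    from [a] to [b] (bottom side), from [b] to [c] (right side) and from [a] to
    [c] (diagonal). *)
Definition mix (i j : nat) : conf G m.
Proof.
refine (@Conf G m (cb a) (mix_mor i j) (@mix_src i j) (@mix_simple i j) _).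
by move=> p hp; apply: mix_le => //; [right|move/leqW|move/leqW].
Defined.

(* Along a step the last [i] entries may grow into the last [i.+1] only: an
   entry may not overtake the current value of its right neighbour. *)
Lemma mix_step i j i' j' : (i <= i' <= i.+1)%N -> (j <= j' <= j.+1)%N ->
  step (mix i j) (mix i' j').
Proof.
move=> /andP [i1 i2] /andP [j1 j2]; split=> // p hp; split.
  by apply: mix_le => //; [left|move=> h; apply: leq_trans h; apply: leq_sub2l..].
rewrite /cnext; case: eqP => [e|/eqP e].
  by apply: ldiv_cwrap => //; [apply: mix_src|apply: mix_simple].
have hp' : (p.+1 < m)%N by rewrite ltn_neqAle e.
have aux k k' : (k' <= k.+1)%N -> (m - k' <= p)%N -> (m - k <= p.+1)%N.
  rewrite !leq_subLR => h1 h2; apply: (leq_trans h2).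
  by rewrite addnS -addSn leq_add2r.
by apply: mix_le => //; [right|apply: aux|apply: aux].
Qed.

Let M (i j k l : nat) := Emor m_gt0 (mix i j) (mix k l).

Let Mcol i j : step (mix i j) (mix i j.+1).
Proof. by apply: mix_step; rewrite ?leqnn ?leqnSn. Qed.
Let Mrow i j : step (mix i j) (mix i.+1 j).
Proof. by apply: mix_step; rewrite ?leqnn ?leqnSn. Qed.
Let Mdiag i j : step (mix i j) (mix i.+1 j.+1).
Proof. by apply: mix_step; rewrite ?leqnn ?leqnSn. Qed.

(* Each unit square of the grid commutes, both of its sides being equal to the
   diagonal edge; the next two lemmas assemble the squares. *)
Lemma mix_row n k : M n 0 n.+1 0 ** PP m_gt0 (mix n.+1) k =
  PP m_gt0 (mix n) k ** M n k n.+1 k.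
Proof.
have sr j : src (M n j n.+1 j) = O m_gt0 (mix n j) by apply: src_Emor.
have tr j : tgt (M n j n.+1 j) = O m_gt0 (mix n.+1 j) by apply: tgt_Emor.
have sc i j : src (M i j i j.+1) = O m_gt0 (mix i j) by apply: src_Emor.
have tc i j : tgt (M i j i j.+1) = O m_gt0 (mix i j.+1) by apply: tgt_Emor.
have sP i j : src (PP m_gt0 (mix i) j) = O m_gt0 (mix i 0) by apply: src_PP.
have tP i j : tgt (PP m_gt0 (mix i) j) = O m_gt0 (mix i j) by apply: tgt_PP.
elim: k => [|k IH].
  by rewrite /PP /= -[X in _ ** idm X]tr compm1 -[X in idm X]sr comp1m.
rewrite !PPS // -![Emor _ _ _]/(M _ _ _ _) compA ?tr ?sP ?tP ?sc // IH.
rewrite -!compA ?tr ?sr ?sc ?tc ?tP //; congr (_ ** _).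
by rewrite !Emor_comp.
Qed.

Lemma mix_diag n : PP m_gt0 (mix^~ 0%N) n ** PP m_gt0 (mix n) n =
  PP m_gt0 (fun i => mix i i) n.
Proof.
have sr i j : src (M i j i.+1 j) = O m_gt0 (mix i j) by apply: src_Emor.
have tr i j : tgt (M i j i.+1 j) = O m_gt0 (mix i.+1 j) by apply: tgt_Emor.
have sc i j : src (M i j i j.+1) = O m_gt0 (mix i j) by apply: src_Emor.
have sP i j : src (PP m_gt0 (mix i) j) = O m_gt0 (mix i 0) by apply: src_PP.
have tP i j : tgt (PP m_gt0 (mix i) j) = O m_gt0 (mix i j) by apply: tgt_PP.
have tQ i : tgt (PP m_gt0 (mix^~ 0%N) i) = O m_gt0 (mix i 0).
  by apply: (tgt_PP _ (a := mix^~ 0%N)).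
elim: n => [|n IH].
  by rewrite /PP /=; have := comp1m (idm (O m_gt0 (mix 0 0) : divided G m));
    rewrite src_id.
rewrite (PPS _ (a := mix^~ 0%N)) // (PPS _ (a := mix n.+1)) //.
rewrite (PPS _ (a := fun i => mix i i)) // -IH -![Emor _ _ _]/(M _ _ _ _).
rewrite -!compA ?src_comp ?tgt_comp ?sr ?tr ?sc ?tP ?tQ ?sP //.
  congr (_ ** _); rewrite compA ?tr ?sP ?tP ?sc // mix_row.
  rewrite -compA ?tP ?sr ?tr ?sc //; congr (_ ** _).
  exact: Emor_comp.
by rewrite src_Emor.
Qed.
End Mix.

Section Interp.
Variables a b : conf G m.
Hypothesis ab : cle a b.

Definition interp (i : nat) : conf G m := mix ab (cle_refl b) i 0.

Lemma interpE i p : (p < m)%N ->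
  interp i p = if (m - i <= p)%N then b p else a p.
Proof. by move=> hp; rewrite /= /mix_mor subn0 leqNgt hp. Qed.

Lemma interp_step i : step (interp i) (interp i.+1).
Proof. by apply: mix_step; rewrite ?leqnn ?leqnSn. Qed.

(** The last entry moves first so that no entry overtakes its right neighbour;
    from the constant configuration [1] to the constant configuration [s] this is
    the path that defines Theta. *)
Definition canon : mor (divided G m) := PP m_gt0 interp m.
End Interp.

Lemma O_ext a b : cb a = cb b -> (forall p, (p < m)%N -> a p = b p) ->
  O m_gt0 a = O m_gt0 b.
Proof.
move=> e h; apply: (@O_translate _ _ _ (idm (cb a))); split=> [||p hp].
- by rewrite tgt_id.
- by rewrite src_id.
by rewrite h // e -(ca_src b hp) comp1m.
Qed.

Lemma PP_ext (a b : nat -> conf G m) n :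
  (forall i, (i < n)%N -> step (a i) (a i.+1) /\ step (b i) (b i.+1)) ->
  (forall i, cb (a i) = cb (b 0%N) /\ cb (b i) = cb (b 0%N)) ->
  (forall i p, (p < m)%N -> a i p = b i p) -> PP m_gt0 a n = PP m_gt0 b n.
Proof.
move=> h1 h2 h3; apply: (PP_translate _ (u := idm (cb (b 0%N)))) => // i.
have [e1 e2] := h2 i; split=> [||p hp].
- by rewrite tgt_id.
- by rewrite src_id.
by rewrite h3 // -e2 -(ca_src (b i) hp) comp1m.
Qed.

Lemma src_canon a b (h : cle a b) : src (canon h) = O m_gt0 a.
Proof.
rewrite /canon src_PP; last by move=> i _; apply: interp_step.
by apply: O_ext => // p hp; rewrite interpE // subn0 leqNgt hp.
Qed.

Lemma tgt_canon a b (h : cle a b) : tgt (canon h) = O m_gt0 b.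
Proof.
rewrite /canon tgt_PP; last by move=> i _; apply: interp_step.
by apply: O_ext => [|p hp]; [exact: h.1|rewrite interpE // subnn].
Qed.

Lemma canon_comp a b c (ab : cle a b) (bc : cle b c) (ac : cle a c) :
  canon ab ** canon bc = canon ac.
Proof.
have st i : step (mix ab bc m i) (mix ab bc m i.+1).
  by apply: mix_step; rewrite ?leqnn ?leqnSn.
have st' i : step (mix ab bc i 0) (mix ab bc i.+1 0).
  by apply: mix_step; rewrite ?leqnn ?leqnSn.
have sd i : step (mix ab bc i i) (mix ab bc i.+1 i.+1).
  by apply: mix_step; rewrite ?leqnn ?leqnSn.
have -> : canon ab = PP m_gt0 (fun i => mix ab bc i 0) m.
  apply: PP_ext => [i _|i|i p hp] //; first by split; [exact: interp_step|].
  by rewrite interpE //= /mix_mor subn0 [(m <= p)%N]leqNgt hp.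
have -> : canon bc = PP m_gt0 (mix ab bc m) m.
  apply: PP_ext => [i _|i|i p hp]; first by split; [exact: interp_step|].
    by rewrite /= ab.1.
  by rewrite interpE //= /mix_mor subnn.
have -> : canon ac = PP m_gt0 (fun i => mix ab bc i i) m.
  apply: PP_ext => [i _|i|i p hp] //; first by split; [exact: interp_step|].
  by rewrite interpE //= /mix_mor; case: ifP.
exact: mix_diag.
Qed.

(** When [a -> b] is an edge, so is [a -> interp i] for every [i], and the
    partial products of the canonical path collapse one after the other. *)
Lemma canon_step a b (h : cle a b) : step a b -> canon h = Emor m_gt0 a b.
Proof.
move=> st; have st0 n : step (interp h 0) (interp h n).
  split=> // p hp; split.
    by apply: (mix_le h (cle_refl b)) => //; [left|rewrite subn0 leqNgt hp].
  have [h1 h2] := st.2 _ hp.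
  have -> : cnext (interp h 0) p = cnext a p.
    rewrite /cnext; case: eqP => [_|/eqP e].
      by rewrite /cwrap interpE // subn0 leqNgt m_gt0.
    have hp' : (p.+1 < m)%N by rewrite ltn_neqAle e.
    by rewrite interpE // subn0 leqNgt hp'.
  by rewrite interpE //; case: ifP => _ //; apply: cnext_div.
have key n : PP m_gt0 (interp h) n = Emor m_gt0 (interp h 0) (interp h n).
  elim: n => [|n IH]; first by rewrite Emor_id.
  rewrite PPS => [|i _]; last exact: interp_step.
  by rewrite IH Emor_comp //; apply: interp_step.
rewrite /canon key; apply: (Emor_translate _ (u := idm (cb a))) => //.
- split=> [||p hp]; rewrite ?tgt_id ?src_id //.
  by rewrite interpE // subn0 leqNgt hp /= -(ca_src a hp) comp1m.
split=> [||p hp]; rewrite ?tgt_id ?src_id ?(h.1) //.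
by rewrite interpE // subnn /= -(ca_src b hp) comp1m.
Qed.

Lemma canon_translate u a b a' b' (h : cle a b) (h' : cle a' b') :
  translate u a a' -> translate u b b' -> canon h = canon h'.
Proof.
move=> [t1 t2 t3] [_ _ t3']; apply: (PP_translate _ (u := u)) => [i _|i].
  by split; apply: interp_step.
split=> // p hp; rewrite !interpE //; case: ifP => _; auto.
Qed.

(** The counterpart on configurations of the [m]-th power of the automorphism of
    the divided category ([O_cphi], [Emor_cphi]). *)
Definition cphi a : conf G m.
Proof.
refine (@Conf G m (phi (cb a)) (fun p => fmor phi (a p)) _ _ _).
- by move=> p hp; rewrite fsrc ca_src.
- by move=> p hp; apply/simple_phi/ca_simple.
- by move=> p hp; apply/ldiv_phi/ca_mono.
Defined.

Lemma cnext_cphi a p : cnext (cphi a) p = fmor phi (cnext a p).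
Proof.
rewrite /cnext; case: eqP => _ //; rewrite /cwrap fcomp ?phi_Delta //.
by rewrite tgt_Delta fsrc ca_src.
Qed.

Lemma O_cphi a : O m_gt0 (cphi a) = iter m (@dphi G m) (O m_gt0 a).
Proof.
apply: dobj_inj => i; rewrite tnth_iter_dphi !tnth_otup cnext_cphi phi_lq //.
exact: cnext_div.
Qed.

Lemma cphi_step a b : step a b -> step (cphi a) (cphi b).
Proof.
case=> e h; split=> [|p hp]; first by rewrite /= e.
by have [h1 h2] := h p hp; rewrite cnext_cphi; split; apply: ldiv_phi.
Qed.

Lemma Emor_cphi a b : step a b -> Emor m_gt0 (cphi a) (cphi b) =
  iter m (fmor Phi) (Emor m_gt0 a b).
Proof.
move=> st; have [h1 h2 h3] := iter_twist_edge (E m_gt0 st).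
rewrite (EmorE _ st) (EmorE _ (cphi_step st)) iter_Phi_dgen; congr dgen.
apply: dedge_inj => [||i]; 
  [by rewrite h1; apply: O_cphi|by rewrite h2; apply: O_cphi|].
rewrite h3 !tnth_mktuple phi_lq //; by case: (st.2 _ (ltn_ord i)).
Qed.

Lemma PP_cphi (a : nat -> conf G m) n :
  (forall i, (i < n)%N -> step (a i) (a i.+1)) ->
  PP m_gt0 (fun i => cphi (a i)) n = iter m (fmor Phi) (PP m_gt0 a n).
Proof.
elim: n => [|n IH] h.
  rewrite -[PP m_gt0 a 0]/(@idm (divided G m) (O m_gt0 (a 0%N))) fmor_iter_id.
  by rewrite -[iter m _ _]O_cphi.
have h' i : (i < n)%N -> step (a i) (a i.+1) by move/ltnW/h.
rewrite PPS => [|i /h]; last exact: cphi_step.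
rewrite PPS // fmor_iter_comp; last by rewrite tgt_PP // src_Emor //; apply: h.
by rewrite IH // Emor_cphi //; apply: h.
Qed.

Lemma cphi_cle a b : cle a b -> cle (cphi a) (cphi b).
Proof.
case=> e h; split=> [|p hp]; first by rewrite /= e.
exact/ldiv_phi/h.
Qed.

Lemma canon_cphi a b (h : cle a b) (h' : cle (cphi a) (cphi b)) :
  canon h' = iter m (fmor Phi) (canon h).
Proof.
rewrite /canon -PP_cphi => [|i _]; last exact: interp_step.
apply: PP_ext => [i _|i|i p hp] //.
  by split; [|apply: cphi_step]; apply: interp_step.
by rewrite [LHS]interpE // -[RHS]/(fmor phi (interp h i p)) interpE //; case: ifP.
Qed.

(** Moving every entry to the next one is a step because each entry divides its
    successor, and the successive quotients then move one place: this step is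
    the Garside element. *)
Definition cshift a b : Prop :=
  cb a = cb b /\ forall p, (p < m)%N -> b p = cnext a p.

Lemma cshift_step a b : cshift a b -> step a b.
Proof.
case=> e h; split=> // p hp; rewrite h //; split; last exact: ldiv_refl.
exact: cnext_div.
Qed.

Lemma cshiftE a b : cshift a b -> O m_gt0 b = dphi (O m_gt0 a) /\
  Emor m_gt0 a b = dDelta (O m_gt0 a).
Proof.
move=> hab; have st := cshift_step hab; have [e h] := hab.
have eab : etup a b = otup a.
  by apply: eq_from_tnth => i; rewrite !tnth_mktuple h.
have eO : O m_gt0 b = dphi (O m_gt0 a).
  apply: dobj_inj => i; rewrite tnth_otup -[tnth (dphi _) i]/(tnth (twist (otup a)) i).
  rewrite -eab.
  by have [-> _] := twist_etup m_gt0 i st; rewrite h.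
split=> //; rewrite (EmorE _ st); congr dgen.
by apply: dedge_inj => // i; rewrite -[LHS]/(tnth (etup a b) i) eab.
Qed.

Lemma PP_cshift (a : nat -> conf G m) n :
  (forall i, (i < n)%N -> cshift (a i) (a i.+1)) ->
  PP m_gt0 a n = @Dpow (divided G m) (@dphi G m) (@dDelta G m) (O m_gt0 (a 0%N)) n
  /\ O m_gt0 (a n) = iter n (@dphi G m) (O m_gt0 (a 0%N)).
Proof.
elim: n => [|n IH] h //.
have [i /ltnW /h //|IH1 IH2] := IH; have [e1 e2] := cshiftE (h n (ltnSn n)).
rewrite PPS => [|i /h]; last exact: cshift_step.
split; last by rewrite e1 IH2.
rewrite -[X in Dpow _ _ _ X]addn1 DpowD; first last.
- exact: tgt_dDelta.
- exact: src_dDelta.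
by rewrite -IH1 e2 IH2 /Dpow /= compm1.
Qed.
End Canonical.

Section CanonExt.
Variables (G : garside) (m : nat).
Hypothesis m_gt0 : (0 < m)%N.

Lemma canon_ext (a b a' b' : conf G m) (h : cle a b) (h' : cle a' b') :
  cb a = cb a' -> (forall l, (l < m)%N -> a l = a' l) ->
  (forall l, (l < m)%N -> b l = b' l) -> canon m_gt0 h = canon m_gt0 h'.
Proof.
move=> e ea eb; apply: (canon_translate _ (u := idm (cb a))).
  split=> [||l hl]; rewrite ?tgt_id ?src_id //.
  by rewrite -ea // -(ca_src a hl) comp1m.
have [[eab _] [eab' _]] := (h, h').
split=> [||l hl]; rewrite ?tgt_id ?src_id // ?e //.
by rewrite -eb // -e eab -(ca_src b hl) comp1m.
Qed.

Lemma iter_cphiE n (a : conf G m) : cb (iter n (@cphi G m) a) = iter n (fob phi) (cb a)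
  /\ forall l, iter n (@cphi G m) a l = iter n (fmor phi) (a l).
Proof. by elim: n => //= n [-> h]; split=> // l; rewrite h. Qed.

Lemma canon_iter_cphi n (a b : conf G m) (h : cle a b)
    (h' : cle (iter n (@cphi G m) a) (iter n (@cphi G m) b)) :
  canon m_gt0 h' = iter (n * m) (fmor Phi) (canon m_gt0 h).
Proof.
elim: n h' => [|n IH] h'; first exact: canon_ext.
have hn : cle (iter n (@cphi G m) a) (iter n (@cphi G m) b).
  by elim: n {IH h'} => //= n; apply: cphi_cle.
by rewrite mulSn iterD -(IH hn) -(canon_cphi _ _ h').
Qed.
End CanonExt.

(** * The functor to the divided category on simple morphisms *)

Section ThetaSimple.
Variables (G : garside) (m : nat).
Hypothesis m_gt0 : (0 < m)%N.

Lemma is_id_inj (C : category) (f g : mor C) :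
  is_id f -> is_id g -> src f = src g -> f = g.
Proof. by rewrite /is_id => -> ->; rewrite !src_id => ->. Qed.

Lemma tnth_TO x (i : 'I_m) :
  tnth (TO m_gt0 x : dobj G m) i = if i.+1 == m then Delta x else idm x.
Proof.
have h p : (p < m)%N -> A1 m (simple_id x) 0 p = idm x.
  by move=> hp; rewrite A1E // src_id if_same.
rewrite tnth_otup /cnext /cwrap (h i) // (h 0%N) //.
case: eqP => [_|/eqP e].
  rewrite /= src_id fid -tgt_Delta compm1.
  by apply/lq_eq/composes_id1; rewrite src_Delta.
by rewrite h 1?ltn_neqAle ?e ?ltn_ord // (lqK (x := x)) // tgt_id.
Qed.

Lemma Theta_ob x : fob (Theta G m_gt0) x = TO m_gt0 x.
Proof.
have [h _] := ThetaP G m_gt0.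
by apply: dobj_inj => i; rewrite tnth_TO; apply: h.
Qed.

Section Path.
Variables (s s' : mor G) (hs : simple s).
Hypothesis hc : composes s s' (Delta (src s)).

Lemma A1_entry j (i : 'I_m) : (0 < j < m)%N ->
  [/\ i.+1 = (m - j)%N -> tnth (O m_gt0 (A1 m hs j)) i = s,
      i.+1 = m -> tnth (O m_gt0 (A1 m hs j)) i = s'
    & i.+1 <> (m - j)%N -> i.+1 <> m ->
      is_id (tnth (O m_gt0 (A1 m hs j)) i)].
Proof.
move=> /andP [j0 jm]; have hi := ltn_ord i.
have mj : (m - j < m)%N by rewrite ltn_subrL j0 m_gt0.
rewrite tnth_otup /cnext A1E //; split=> [e|e|n1 n2].
- have hi' : (i.+1 < m)%N by rewrite e.
  rewrite (ltn_eqF hi') A1E // -e ltnn leqnn; exact/lq_eq/composes_id1.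
- rewrite e eqxx /cwrap A1E // leqn0 subn_eq0 [(m <= j)%N]leqNgt jm fid /=.
  rewrite -tgt_Delta compm1 -ltnS e mj; exact: lq_eq.
have hi' : (i.+1 < m)%N by rewrite ltn_neqAle hi andbT; apply/eqP.
rewrite (ltn_eqF hi') A1E // [(m - j <= i.+1)%N]leq_eqVlt ltnS.
case: eqP => [e|_]; first by case: n1.
by case: ifP => _; rewrite (lqK erefl) /is_id src_id.
Qed.

Lemma A1_edge j (i : 'I_m) : (j < m)%N ->
  (i.+1 = (m - j)%N -> tnth (E m_gt0 (A1_step m_gt0 hs j)) i = s) /\
  (i.+1 <> (m - j)%N -> is_id (tnth (E m_gt0 (A1_step m_gt0 hs j)) i)).
Proof.
move=> jm; rewrite tnth_mktuple !A1E //; split=> [e|n].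
  rewrite -e ltnn subnS -e leqnn; exact/lq_eq/composes_id1.
rewrite subnS; have -> : ((m - j).-1 <= i)%N = (m - j <= i)%N.
  have h : (m - j).-1.+1 = (m - j)%N by rewrite prednK // subn_gt0.
  by rewrite leq_eqVlt -ltnS h -eqSS h; case: eqP => // e; case: n.
by case: ifP => _; rewrite (lqK erefl) /is_id src_id.
Qed.

(** The conditions on the entries of the [A j] leave open at which object an
    identity entry sits; this is forced by the sources and targets of the
    edges, one after the other from [A 0]. *)
Lemma Theta_simple : fmor (Theta G m_gt0) s = T m_gt0 s.
Proof.
have [_ /(_ _ _ hc) [A [e [[A0 Am] hA he hei ->]]]] := ThetaP G m_gt0.
rewrite !Theta_ob in A0 Am *; rewrite (TE _ hs).
have edge j (i : 'I_m) : (j < m)%N -> A j = O m_gt0 (A1 m hs j) ->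
    tnth (e j.+1) i = tnth (E m_gt0 (A1_step m_gt0 hs j)) i.
  move=> jm ej; have [h1 h2] := A1_edge i jm.
  have [k1 k2] := hei j.+1 i jm; rewrite addn1 subSS in k1 k2.
  have [es et] := he j.+1 jm.
  case: (i.+1 =P (m - j)%N) => [d|d]; first by rewrite h1 // k1.
  apply: is_id_inj; [exact: k2|exact: h2|].
  have [_ -> _ _] := dedgeP (e j.+1) i.
  have [_ -> _ _] := dedgeP (E m_gt0 (A1_step m_gt0 hs j)) i.
  by rewrite es /= ej.
have obj j : (j <= m)%N -> A j = O m_gt0 (A1 m hs j).
  elim: j => [|j IH] hj; first by rewrite A0 TO_start.
  have [ejm|/eqP njm] := j.+1 =P m; first by rewrite ejm Am TO_end.
  have {}IH := IH (ltnW hj); apply: dobj_inj => i.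
  have hj' : (0 < j.+1 < m)%N by rewrite /= ltn_neqAle njm.
  have [h1 h2 h3] := A1_entry i hj'; have [k1 k2 k3] := hA _ i hj'.
  case: (i.+1 =P (m - j.+1)%N) => [d|d]; first by rewrite h1 // k1.
  case: (i.+1 =P m) => [d'|d']; first by rewrite h2 // k2.
  apply: is_id_inj; [exact: k3|exact: h3|].
  have [es et] := he j.+1 hj.
  have [_ _ k _] := dedgeP (e j.+1) i; rewrite et in k; rewrite -k edge //.
  by have [_ _ -> _] := dedgeP (E m_gt0 (A1_step m_gt0 hs j)) i.
rewrite /PP TO_start (iotaDl 1 0) -map_comp; congr product.
apply/eq_in_map => j; rewrite mem_iota => hj; rewrite [LHS]/=.
have [es et] := he j.+1 hj.
rewrite (EmorE _ (A1_step m_gt0 hs j)); congr dgen; apply: dedge_inj => [||i].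
- by rewrite [LHS]es /= obj // ltnW.
- by rewrite [LHS]et /= obj.
by apply: edge => //; apply: obj; apply: ltnW.
Qed.
End Path.

Definition cconst (f : mor G) (hf : simple f) : conf G m :=
  @Conf G m (src f) (fun _ => f) (fun _ _ => erefl) (fun _ _ => hf)
    (fun _ _ => ldiv_refl f).

Lemma cle_const x s (hs : simple s) : src s = x ->
  cle (cconst (simple_id x)) (cconst hs).
Proof.
move=> <-; split=> [|p _]; first by rewrite /= src_id.
by exists s; apply: composes_id1.
Qed.

Lemma Theta_canon x s (hs : simple s) (h : src s = x) :
  fmor (Theta G m_gt0) s = canon m_gt0 (cle_const hs h).
Proof.
have [s' hc] := hs; rewrite (Theta_simple hs hc) (TE _ hs).
apply: PP_ext => [i _|i|i p hp].
- by split; [apply: A1_step|exact: interp_step].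
- by rewrite /= src_id -h.
by rewrite interpE // A1E //= h.
Qed.

Lemma TO_const x : TO m_gt0 x = O m_gt0 (cconst (simple_id x)).
Proof.
apply: O_ext => [|p hp]; first by rewrite /= !src_id.
by rewrite A1E // src_id if_same.
Qed.

(** The image of [Delta] is the path of configurations in which the entry
    [Delta] invades the tuple from the right, one place at each step: each step
    is a shift, hence a Garside element. *)
Lemma Theta_Delta x : fmor (Theta G m_gt0) (Delta x) =
    @Dpow (divided G m) (@dphi G m) (@dDelta G m) (TO m_gt0 x) m
  /\ TO m_gt0 (phi x) = iter m (@dphi G m) (TO m_gt0 x).
Proof.
have hs : simple (Delta x).
  apply/(simple_ldiv (x := x)); [exact: src_Delta|exact: ldiv_refl].
have hc : composes (Delta x) (idm (phi x)) (Delta (src (Delta x))).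
  by rewrite src_Delta; apply: composes_id2; apply: tgt_Delta.
rewrite (Theta_simple hs hc) (TE _ hs).
have sh j : (j < m)%N -> cshift (A1 m hs j) (A1 m hs j.+1).
  move=> hj.
  split=> // p hp; rewrite /cnext; case: eqP => [ep|/eqP ep].
    have hj0 : (m - j <= 0)%N = false by rewrite leqn0 subn_eq0 leqNgt hj.
    rewrite /cwrap !A1E // hj0 fid /= !src_Delta -tgt_Delta compm1.
    by rewrite leq_subLR addSnnS ep leq_addl.
  rewrite !A1E //; last by rewrite ltn_neqAle ep.
  by rewrite !leq_subLR addSnnS.
have [-> e] := PP_cshift m_gt0 sh.
by move: e; rewrite TO_end TO_start src_Delta tgt_Delta => ->.
Qed.

Lemma Theta_Dpow x n : fmor (Theta G m_gt0) (Dpow (fob phi) Delta x n) =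
    @Dpow (divided G m) (@dphi G m) (@dDelta G m) (TO m_gt0 x) (n * m)
  /\ TO m_gt0 (iter n (fob phi) x) = iter (n * m) (@dphi G m) (TO m_gt0 x).
Proof.
elim: n x => [|n IH] x.
  by split=> //; rewrite /Dpow /= fid Theta_ob.
have [e1 e2] := Theta_Delta x; have [IH1 IH2] := IH (phi x).
have sD := src_Dpow (@src_Delta G) (@tgt_Delta G).
rewrite (DpowS (@tgt_Delta G)) fcomp ?tgt_Delta ?sD // e1 IH1 mulSn.
rewrite (DpowD (C := divided G m) (@src_dDelta G m) (@tgt_dDelta G m)).
by rewrite e2 iterSr IH2 e2 addnC iterD.
Qed.
End ThetaSimple.

(** * Length in the Garside groupoid *)

Section GroupoidLength.
Import GRing.Theory.
Local Open Scope ring_scope.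
Variables (C : category) (L : mor C -> nat).
Hypothesis L_id : forall x, L (idm x) = 0%N.
Hypothesis L_comp : forall f g, tgt f = src g -> L (f ** g) = (L f + L g)%N.

(* The integers as a category with one object, so that an additive length on
   [C] is a functor and extends to the groupoid by its universal property. *)
Definition int_quiver : quiver :=
  @Quiver unit int (fun _ => tt) (fun _ => tt).

Definition int_category : category.
Proof.
refine (@Category int_quiver (fun _ => 0 : int)
  (fun f g : int => f + g : int) _ _ _ _ _ _ _) => //=.
- by case.
- by case.
- by move=> f; rewrite add0r.
- by move=> f; rewrite addr0.
- by move=> f g h _ _; rewrite addrA.
Defined.

Definition loc_length (e : mor (loc_quiver C)) : mor int_category :=
  match e with inl f => (L f)%:Z | inr f => - (L f)%:Z end.

Lemma loc_length_rel (x y : loc_quiver C) a b : loc_rel a b ->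
  chain x a y -> chain x b y ->
  product (tt : int_category) (map loc_length a) =
  product (tt : int_category) (map loc_length b).
Proof.
by case=> [z|f g h|f|f] _ _; rewrite /= /mcomp /= /idm /=
  ?L_id ?L_comp // ?addr0 ?subrr ?addNr.
Qed.

Lemma groupoid_length : exists len : mor (groupoid C) -> int,
  [/\ forall f, len (emb f) = (L f)%:Z,
      forall f, len (embV f) = - (L f)%:Z,
      forall x : groupoid C, len (idm x) = 0
    & forall c d : mor (groupoid C), tgt c = src d ->
        len (c ** d) = len c + len d].
Proof.
pose F : functor (groupoid C) int_category :=
  @Defs.lift (loc_quiver C) _ int_category (fun _ => tt) loc_length
    (fun _ => erefl) (fun _ => erefl) loc_length_rel.
exists (fmor F); split.
- by move=> f; rewrite /emb [LHS]lift_gen.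
- by move=> f; rewrite /embV [LHS]lift_gen.
- by move=> x; rewrite fid.
by move=> c d e; rewrite fcomp.
Qed.
End GroupoidLength.

Section InvariantLength.
Variable G : garside.
Hypothesis hcyclic : cyclic G.

(** Summing any length over a period of [phi] makes it invariant under [phi]. *)
Lemma invariant_length : exists L : mor G -> nat,
  [/\ forall f g, tgt f = src g -> L (f ** g) = (L f + L g)%N,
      forall f, L f = 0%N <-> is_id f & forall f, L (fmor phi f) = L f].
Proof.
have [[|N] [// _ [_ hN]]] := hcyclic.
have [l [lM l0]] := garside_hom G.
exists (fun f => \sum_(i < N.+1) l (iter i (fmor phi) f))%N; split=> [f g e|f|f].
- rewrite -big_split; apply: eq_bigr => i _ /=; rewrite fmor_iter_comp // lM //.
  by elim: (val i) => //= n IH; rewrite ftgt fsrc IH.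
- split=> [/eqP|hf].
    by rewrite big_ord_recl addn_eq0 => /andP [/eqP /l0].
  apply: big1 => i _; apply/l0; rewrite hf fmor_iter_id.
  by rewrite /is_id src_id.
rewrite big_ord_recr big_ord_recl /= -!iterSr hN addnC; congr addn.
by apply: eq_bigr => i _; rewrite -iterSr.
Qed.
End InvariantLength.

Section Periodic.
Variable G : garside.

Section WithLength.
Variable L : mor G -> nat.
Hypothesis L_comp : forall f g, tgt f = src g -> L (f ** g) = (L f + L g)%N.
Hypothesis L_id : forall f, L f = 0%N <-> is_id f.
Hypothesis L_phi : forall f, L (fmor phi f) = L f.

Lemma length_Delta f : L (Delta (tgt f)) = L (Delta (src f)).
Proof.
have := congr1 L (Delta_nat f).
rewrite !L_comp ?src_Delta ?tgt_Delta ?fsrc // L_phi addnC.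
by move/addIn.
Qed.

Lemma length_Delta_phi x : L (Delta (phi x)) = L (Delta x).
Proof. by have := length_Delta (Delta x); rewrite tgt_Delta src_Delta. Qed.

Lemma length_Delta_phiV x : L (Delta (phiV x)) = L (Delta x).
Proof. by rewrite -(length_Delta_phi (phiV x)) phiV_obK. Qed.

Lemma length_phi_pow k f : L (phi_pow k f) = L f.
Proof.
have LV g : L (fmor phiV g) = L g by rewrite -L_phi phiV_morK.
case: k => n; rewrite /phi_pow; first by elim: n => //= n IH; rewrite L_phi.
by elim: n.+1 => //= {}n IH; rewrite LV.
Qed.

Lemma length_Dpow x n : L (Dpow (fob phi) Delta x n) = (n * L (Delta x))%N.
Proof.
elim: n x => [|n IH] x; first by apply/L_id; rewrite /is_id src_id.
rewrite (DpowS (@tgt_Delta G)) L_comp; last first.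
  by rewrite tgt_Delta (src_Dpow (@src_Delta G) (@tgt_Delta G)).
by rewrite IH length_Delta_phi mulSn.
Qed.

Lemma length_product x l y : chain x l y ->
  L (product x l) = (\sum_(f <- l) L f)%N.
Proof.
elim: l x => [|f l IH] x /=.
  by move=> _; rewrite big_nil; apply/L_id; rewrite /is_id src_id.
by case=> _ h; rewrite big_cons L_comp ?(src_product h) // (IH _ h).
Qed.

End WithLength.

Section Exponent.
Import GRing.Theory Num.Theory.
Local Open Scope ring_scope.
Variables (p q : nat) (k : int) (s : mor G).
Hypothesis q_gt0 : (0 < q)%N.
Hypothesis hprod : is_divided (twisted_powers q k s).

Lemma divided_src : chain (src s) (twisted_powers q k s) (phi (src s)) /\
  product (src s) (twisted_powers q k s) = Delta (src s).
Proof.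
have [x [h1 h2]] := hprod.
suff -> : src s = x by [].
have e : nth s (twisted_powers q k s) 0 = s.
  rewrite -[0%N]/(val (Ordinal q_gt0)) -tnth_nth tnth_mktuple /=.
  by rewrite mul0r oppr0.
move: h1 e; have := size_tuple (twisted_powers q k s).
by case: (tval _) => [e|f l _ [<- _] /= ->] //; move: q_gt0; rewrite -e.
Qed.

(** Lengths turn [rho ^ q = Delta ^ p] into [lambda (q k + 1) = lambda p], with
    [lambda] the length of [Delta]; a vanishing [lambda] means that [Delta] is
    an identity. Since [p] is positive, [k] is then nonnegative. *)
Lemma periodic_exponent (rho : mor (groupoid G)) : cyclic G -> (0 < p)%N ->
  composes (emb s) (Delta_pow (tgt s) k) rho -> periodic p q rho ->
  is_id (Delta (src s)) \/ exists n, k = Posz n /\ p = (n * q).+1.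
Proof.
move=> hcyclic hp hrho [hloop hper].
have [L [L_comp L_id L_phi]] := invariant_length hcyclic.
have [|len [len_emb len_embV len_id len_comp]] := @groupoid_length G L _ L_comp.
  by move=> x; apply/L_id; rewrite /is_id src_id.
have [/L_id|/eqP hlam] := L (Delta (src s)) =P 0%N; first by left.
right; set lam := L (Delta (src s)) in hlam.
have [hch hpr] := divided_src.
have ls : lam = (q * L s)%N.
  rewrite /lam -hpr (length_product L_comp L_id hch) big_tuple.
  rewrite -[X in (X * _)%N]card_ord -sum_nat_const; apply: eq_bigr => i _.
  by rewrite tnth_mktuple length_phi_pow.
have ld j y : L (Delta y) = lam -> len (Delta_pow y j) = j * lam%:Z.
  case: j => n hy; first by rewrite /= len_emb length_Dpow // hy PoszM.
  rewrite [LHS]len_embV length_Dpow // NegzE PoszM mulNr; congr (- (_ * _)).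
  rewrite -hy; congr Posz.
  by elim: n.+1 => //= n' IH; rewrite length_Delta_phiV.
have hy : L (Delta (tgt s)) = lam by apply: length_Delta.
have lrho : len rho = (L s)%:Z + k * lam%:Z.
  by case: hrho => e <-; rewrite len_comp // len_emb ld.
have sr : src rho = src s by case: hrho => e <-; rewrite src_comp // src_emb.
have lpow n : len (power rho n) = n%:Z * len rho /\ src (power rho n) = src rho.
  rewrite /power; elim: n => [|n [IH1 IH2]].
    rewrite -[product _ _]/(@idm (groupoid G) (src rho)).
    by rewrite len_id mul0r src_id.
  rewrite -[product _ _]/(rho ** product (tgt rho) (nseq n rho)).
  have e : tgt rho = src (product (tgt rho) (nseq n rho)) by rewrite -hloop IH2.
  by rewrite src_comp // len_comp // -hloop IH1 -addn1 PoszD mulrDl mul1r addrC.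
have : p%:Z * lam%:Z = q%:Z * ((L s)%:Z + k * lam%:Z).
  by rewrite -lrho -(lpow q).1 hper ld // sr.
move: hlam hp; rewrite ls => h0 hp.
case: k => n e; first by exists n; split=> //; nia.
nia.
Qed.
End Exponent.
End Periodic.

(** * The path of the partial products of the twisted powers *)

Section Twisted.
Variables (G : garside) (q n : nat) (s : mor G).
Hypothesis q_gt0 : (0 < q)%N.
Hypothesis hloop : iter n (fob phi) (tgt s) = src s.
Hypothesis hprod : is_divided (twisted_powers q (Posz n) s).

(* [tw i] is the morphism [s_(i+1)]; unlike the tuple it is defined for all
   [i]. *)
Definition tw (i : nat) : mor G := iter (i * n) (fmor phiV) s.

Lemma tnth_twisted (i : 'I_q) : tnth (twisted_powers q (Posz n) s) i = tw i.
Proof. by rewrite tnth_mktuple -PoszM /tw; case: (i * n)%N. Qed.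

Lemma twisted_val : tval (twisted_powers q (Posz n) s) = map tw (iota 0 q).
Proof.
rewrite /= -val_enum_ord -map_comp; apply: eq_map => i /=.
by rewrite -tnth_twisted tnth_mktuple.
Qed.

Lemma phi_tw i : iter n (fmor phi) (tw i.+1) = tw i.
Proof.
rewrite /tw mulSn iterD; move: (iter (i * n) _ s) => f.
elim: n => // j IH; rewrite iterSr [iter j.+1 (fmor phiV) _]iterS.
by rewrite phiV_morK.
Qed.

Lemma tw_chain i : tgt (tw i) = src (tw i.+1).
Proof.
have hV j f : src (iter j (fmor phiV) f) = iter j (fob (@phiV G)) (src f) /\
    tgt (iter j (fmor phiV) f) = iter j (fob phiV) (tgt f).
  by elim: j => //= j [<- <-]; rewrite fsrc ftgt.
have hK j (x : G) : iter j (fob phiV) (iter j (fob phi) x) = x.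
  by elim: j => // j IH; rewrite iterSr iterS phi_obK.
by rewrite /tw (hV _ _).1 (hV _ _).2 mulSn addnC iterD -hloop hK.
Qed.

Definition twprod (i l : nat) : mor G :=
  product (src (tw i)) (map tw (iota i l)).

Lemma twprod_chain i l : chain (src (tw i)) (map tw (iota i l)) (src (tw (i + l))).
Proof.
elim: l i => [|l IH] i; first by rewrite addn0.
by rewrite addnS -addSn; split=> //; rewrite tw_chain.
Qed.

Lemma src_twprod i l : src (twprod i l) = src (tw i).
Proof. exact: src_product (twprod_chain i l). Qed.

Lemma tgt_twprod i l : tgt (twprod i l) = src (tw (i + l)).
Proof. exact: tgt_product (twprod_chain i l). Qed.

Lemma twprodS i l : composes (twprod i l) (tw (i + l)) (twprod i l.+1).
Proof.
split; first by rewrite tgt_twprod.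
rewrite /twprod -[in RHS]addn1 iotaD map_cat.
have h : chain (src (tw (i + l))) [:: tw (i + l)] (tgt (tw (i + l))) by [].
by rewrite (product_cat (twprod_chain i l) h) product1.
Qed.

Lemma twprod_cons i l : composes (tw i) (twprod i.+1 l) (twprod i l.+1).
Proof.
by split; rewrite ?src_twprod ?tw_chain // /twprod [RHS]/= tw_chain.
Qed.

Lemma ldiv_twprod i l : ldiv (twprod i l) (twprod i l.+1).
Proof. by exists (tw (i + l)); apply: twprodS. Qed.

Lemma phi_twprod i l : iter n (fmor phi) (twprod i.+1 l) = twprod i l.
Proof.
have hf (f : mor G) : src (iter n (fmor phi) f) = iter n (fob phi) (src f).
  by elim: n => //= j <-; rewrite fsrc.
elim: l i => [|l IH] i.
  by rewrite /twprod /= fmor_iter_id -hf phi_tw.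
have [e1 <-] := twprod_cons i.+1 l; have [_ <-] := twprod_cons i l.
by rewrite fmor_iter_comp // phi_tw IH.
Qed.

Lemma twprod_Delta : twprod 0 q = Delta (src s).
Proof. by have [_ <-] := divided_src q_gt0 hprod; rewrite twisted_val. Qed.

Lemma simple_twprod l : (l <= q)%N -> simple (twprod 0 l).
Proof.
move=> hl; apply/(simple_ldiv (x := src s)); first exact: src_twprod.
rewrite -twprod_Delta -(subnKC hl); elim: (q - l)%N => [|d IH].
  by rewrite addn0; apply: ldiv_refl.
by apply: ldiv_trans IH _; rewrite addnS; apply: ldiv_twprod.
Qed.

Lemma simple_s : simple s.
Proof.
have /simple_twprod : (1 <= q)%N by [].
by have [_ <-] := twprodS 0 0; rewrite /twprod /= comp1m.
Qed.

(** The configuration of the object [(s_1, ..., s_q)], with entries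
    [1, s_1, s_1 s_2, ...]. *)
Definition tw_conf : conf G q.
Proof.
refine (@Conf G q (src s) (twprod 0) _ _ _).
- by move=> l _; apply: src_twprod.
- by move=> l hl; apply/simple_twprod/ltnW.
by move=> l _; apply: ldiv_twprod.
Defined.

(** The image of [tw_conf] by the shift, still based at the source of [s]. *)
Definition tw_conf_shift : conf G q.
Proof.
refine (@Conf G q (src s) (fun l => twprod 0 l.+1) _ _ _).
- by move=> l _; apply: src_twprod.
- by move=> l hl; apply/simple_twprod.
by move=> l _; apply: ldiv_twprod.
Defined.

(** The same object as [tw_conf_shift], translated so as to be based at the
    target of [s]; [phi ^ n] maps it to [tw_conf]. *)
Definition tw_conf_tail : conf G q.
Proof.
refine (@Conf G q (tgt s) (twprod 1) _ _ _).
- by move=> l _; rewrite src_twprod -tw_chain.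
- move=> l hl; rewrite -(lq_eq (twprod_cons 0 l)).
  apply: simple_lq; last exact: simple_twprod.
  by exists (twprod 1 l); apply: twprod_cons.
by move=> l _; apply: ldiv_twprod.
Defined.

Lemma tw_cshift : cshift tw_conf tw_conf_shift.
Proof.
split=> // l hl; rewrite /cnext; case: eqP => [e|_] //.
rewrite /= /cwrap /= e twprod_Delta /twprod /= fid -tgt_Delta.
by rewrite compm1.
Qed.

Lemma O_tw_conf : O q_gt0 tw_conf = DObj hprod.
Proof.
apply: dobj_inj => i; rewrite tnth_otup.
rewrite -[RHS]/(tnth (twisted_powers q (Posz n) s) i) tnth_twisted.
have [_ h] := tw_cshift; rewrite -h //.
exact/lq_eq/(twprodS 0 i).
Qed.

Lemma one_le_conf (a : conf G q) x : cb a = x -> cle (cconst q (simple_id x)) a.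
Proof.
move=> e; split=> [|l hl]; first by rewrite /= src_id e.
by exists (a l); apply: composes_id1; rewrite ca_src.
Qed.

Definition conj_mor : mor (divided G q) :=
  canon q_gt0 (@one_le_conf tw_conf (src s) erefl).

Definition conj_tail : mor (divided G q) :=
  canon q_gt0 (@one_le_conf tw_conf_tail (tgt s) erefl).

(** Because [phi ^ n] maps [s_(i+1)] to [s_i], it carries the products
    [s_2 ... s_(l+1)] to [s_1 ... s_l]; and [phi], applied entrywise, is the
    [q]-th power of the automorphism of the divided category. *)
Lemma conj_mor_Phi : conj_mor = iter (n * q) (fmor Phi) conj_tail.
Proof.
have [e1 e2] := iter_cphiE n (cconst q (simple_id (tgt s))).
have [e3 e4] := iter_cphiE n tw_conf_tail.
have h : cle (iter n (@cphi G q) (cconst q (simple_id (tgt s))))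
    (iter n (@cphi G q) tw_conf_tail).
  have := @one_le_conf tw_conf_tail (tgt s) erefl.
  by move: (cconst _ _) (tw_conf_tail) => a b hab; elim: n => //= j; apply: cphi_cle.
rewrite -(canon_iter_cphi _ _ h); apply: canon_ext => [|l hl|l hl].
- by rewrite e1 /= !src_id hloop.
- by rewrite e2 /= fmor_iter_id hloop.
- by rewrite e4 /= phi_twprod.
Qed.

(** Both sides are the canonical morphism from the constant configuration [1] to
    the shift of [(s_1, ..., s_q)]: on the left it passes through the constant
    configuration [s], on the right through [(s_1, ..., s_q)]. *)
Lemma Theta_conj_tail : fmor (Theta G q_gt0) s ** conj_tail =
  conj_mor ** dDelta (DObj hprod).
Proof.
have st : cle tw_conf tw_conf_shift by apply/step_cle/cshift_step/tw_cshift.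
have sb : cle (cconst q simple_s) tw_conf_shift.
  split=> // l hl; exists (twprod 1 l); exact: (twprod_cons 0 l).
have -> : conj_tail = canon q_gt0 sb.
  symmetry; apply: (canon_translate _ (u := s)).
    by split=> [||l hl] //=; rewrite ?src_id ?compm1.
  by split=> // l _; exact: esym (twprod_cons 0 l).2.
have h : cle (cconst q (simple_id (src s))) tw_conf_shift by apply: one_le_conf.
rewrite (Theta_canon q_gt0 simple_s (x := src s) erefl) (canon_comp _ _ _ h).
rewrite -O_tw_conf -(cshiftE q_gt0 tw_cshift).2.
by rewrite -(canon_step _ st) ?(canon_comp _ _ _ h) //; apply/cshift_step/tw_cshift.
Qed.

Lemma src_conj_tail : src conj_tail = TO q_gt0 (tgt s).
Proof. by rewrite src_canon TO_const. Qed.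

Lemma tgt_conj_tail : tgt conj_tail = dphi (DObj hprod).
Proof.
rewrite tgt_canon -O_tw_conf -(cshiftE q_gt0 tw_cshift).1.
symmetry; apply: (@O_translate _ _ _ s); split=> // l _.
exact: esym (twprod_cons 0 l).2.
Qed.

Lemma src_conj_mor : src conj_mor = TO q_gt0 (src s).
Proof. by rewrite src_canon TO_const. Qed.

Lemma tgt_conj_mor : tgt conj_mor = DObj hprod.
Proof. by rewrite tgt_canon O_tw_conf. Qed.

(** The powers of [Delta] become powers of [Delta_q], across which naturality
    turns [conj_mor] into [conj_tail]. *)
Lemma Theta_conj : fmor (Theta G q_gt0) (s ** Dpow (fob phi) Delta (tgt s) n)
    ** conj_mor =
  conj_mor ** @Dpow (divided G q) (@dphi G q) (@dDelta G q) (DObj hprod) (n * q).+1.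
Proof.
have sD := @src_dDelta G q; have tD := @tgt_dDelta G q.
have sP := @src_Dpow (divided G q) (@dphi G q) _ sD tD.
have tP := @tgt_Dpow (divided G q) (@dphi G q) _ sD tD.
have sG := src_Dpow (@src_Delta G) (@tgt_Delta G).
have tG := tgt_Dpow (@src_Delta G) (@tgt_Delta G).
have [e1 e2] := Theta_Dpow q_gt0 (tgt s) n.
have hnat := @Dpow_nat (divided G q) Phi (@dDelta G q) sD tD (@dDelta_nat G q).
have {}hnat := hnat conj_tail (n * q)%N.
rewrite src_conj_tail tgt_conj_tail -conj_mor_Phi in hnat.
rewrite fcomp ?sG // e1 -compA; first last.
- by rewrite tP -e2 hloop src_conj_mor.
- by rewrite ftgt Theta_ob sP.
rewrite -[X in _ ** X]hnat compA ?ftgt ?Theta_ob ?src_conj_tail ?tgt_conj_tail ?sP //.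
rewrite Theta_conj_tail -compA ?tgt_conj_mor ?src_dDelta ?tgt_dDelta ?sP //.
by rewrite (@DpowS (divided G q) (@dphi G q) _ tD).
Qed.
End Twisted.

(** * Identity Garside elements *)

Section Degenerate.
Variables (G : garside) (x : G).
Hypothesis Delta_id : Delta x = idm x.

Lemma phi_fixed : phi x = x.
Proof. by rewrite -tgt_Delta Delta_id tgt_id. Qed.

Lemma simple_degenerate s : simple s -> src s = x -> s = idm x.
Proof.
have [len [lenM len0]] := garside_hom G.
move=> [u [e hu]] hs; have : len (s ** u) = 0%N.
  by rewrite hu hs Delta_id; apply/len0; rewrite /is_id src_id.
rewrite lenM // => /eqP; rewrite addn_eq0 => /andP [/eqP /len0 h _].
by rewrite h hs.
Qed.

Lemma Delta_pow_degenerate k : Delta_pow x k = @idm (groupoid G) x.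
Proof.
have D n : Dpow (fob phi) Delta x n = idm x by apply: Dpow_id => //; exact: phi_fixed.
case: k => n; first by rewrite /= D emb_id.
have hV j : iter j (fob phiV) x = x.
  by elim: j => //= j ->; rewrite -{1}phi_fixed phi_obK.
rewrite [LHS]/Delta_pow hV D.
have := emb_invr (idm x); rewrite emb_id src_id => <-.
have := comp1m (embV (idm x)); rewrite src_embV tgt_id => ->.
by [].
Qed.

Lemma phi_pow_degenerate k : phi_pow k (idm x) = idm x.
Proof.
have hV : phiV x = x by rewrite -{1}phi_fixed phi_obK.
case: k => n; rewrite /phi_pow.
  by elim: n => //= n ->; rewrite fid phi_fixed.
by elim: n.+1 => //= {}n ->; rewrite fid hV.
Qed.

Lemma divided_degenerate q (q_gt0 : (0 < q)%N) (f : dobj G q) n :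
  (forall i, tnth f i = idm x) ->
  f = TO q_gt0 x /\ @Dpow (divided G q) (@dphi G q) (@dDelta G q) f n =
    @idm (divided G q) f.
Proof.
move=> hf; split.
  by apply: dobj_inj => i; rewrite tnth_TO hf Delta_id if_same.
have hphi : dphi f = f.
  apply: dobj_inj => i; rewrite -[LHS]/(tnth (twist f) i) tnth_twist !hf.
  by rewrite fid phi_fixed if_same.
apply: Dpow_id => //; rewrite /dDelta dgen_id // => i.
by rewrite /= hf /is_id src_id.
Qed.
End Degenerate.

Theorem theorem10p1 (G : garside) (hcyclic : cyclic G)
    (p q : nat) (hp : (0 < p)%N) (hq : (0 < q)%N)
    (k : int) (s : mor G) (hs : simple s)
    (rho : mor (groupoid G))
    (hrho : composes (emb s) (Delta_pow (tgt s) k) rho)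
    (hper : periodic p q rho)
    (hprod : is_divided (twisted_powers q k s)) :
  exists c : mor (groupoid (divided G q)),
    [/\ tgt (fmor (gTheta G hq) rho) = src c,
        tgt c = DObj hprod
      & fmor (gTheta G hq) rho ** c = c ** dDelta_pow (DObj hprod) p].
Proof.
have [hD|[n [ek ep]]] := periodic_exponent hq hprod hcyclic hp hrho hper.
  rewrite /is_id src_Delta in hD.
  have es := simple_degenerate hD hs erefl.
  have et : tgt s = src s by rewrite es tgt_id src_id.
  have hf i : tnth (DObj hprod) i = idm (src s).
    by rewrite tnth_mktuple es src_id phi_pow_degenerate.
  have [eO eP] := divided_degenerate hD hq p hf.
  have er : rho = @idm (groupoid G) (src s).
    case: hrho => _ <-; rewrite et Delta_pow_degenerate // {1}es emb_id.
    by have := comp1m (@idm (groupoid G) (src s)); rewrite src_id.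
  exists (@idm (groupoid (divided G q)) (DObj hprod)).
  rewrite er fid [fob _ _]Theta_ob -eO src_id tgt_id /dDelta_pow eP emb_id.
  by split.
subst k p; have [hsrc _] := hper; have [hc er] := hrho.
have tD := tgt_Dpow (@src_Delta G) (@tgt_Delta G).
have sD := src_Dpow (@src_Delta G) (@tgt_Delta G).
have hloop : iter n (fob phi) (tgt s) = src s.
  move: hsrc; rewrite -er src_comp // tgt_comp // src_emb /= tgt_emb tD.
  by move=> ->.
have er' : fmor (gTheta G hq) rho =
    emb (fmor (Theta G hq) (s ** Dpow (fob phi) Delta (tgt s) n)).
  rewrite -er -[Delta_pow _ _]/(emb _) -emb_comp ?sD //.
  exact: groupoid_functor_emb.
have tT : tgt (fmor (Theta G hq) (s ** Dpow (fob phi) Delta (tgt s) n)) =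
    TO hq (src s).
  by rewrite ftgt Theta_ob tgt_comp ?sD // tD hloop.
exists (emb (conj_mor hq hloop hprod)); split.
- by rewrite er' tgt_emb src_emb tT src_conj_mor.
- by rewrite tgt_emb tgt_conj_mor.
rewrite er' -emb_comp ?tT ?src_conj_mor // Theta_conj emb_comp //.
rewrite tgt_conj_mor.
have := @src_Dpow (divided G q) (@dphi G q) _ (@src_dDelta G q) (@tgt_dDelta G q).
by move=> ->.
Qed.
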